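(* Suppose that $R_k>0$ for all $k\in\{0,\dots,N-1\}$, $q_N\ge0$ and $q_N+\bar q_N\ge 0$. Let real numbers $S^x_k,T^x_k,S^{xy}_k,T^{xy}_k,S^y_k,T^y_k$ be defined by $$S^x_N=q_N,\ T^x_N=q_N+\bar q_N,\ S^{xy}_N=-q_N,\ T^{xy}_N=-q_N-\bar q_N,\ S^y_N=q_N,\ T^y_N=q_N+\bar q_N,$$ and, for $k=N-1,\dots,0$, with $$W^{(1)}_k=R_k+S^x_{k+1}\mathbb E(B_k^TB_k),\qquad W^{(2)}_k=R_k+T^x_{k+1}\mathbb EB_k^T\,\mathbb EB_k+S^x_{k+1}\mathrm{Cov}(B_k),$$ $$H^{(1)}_k=a_kS^x_{k+1}\mathbb EB_k,\quad H^{(2)}_k=a_kT^x_{k+1}\mathbb EB_k,\quad H^{(3)}_k=f_kS^{xy}_{k+1}\mathbb EB_k,\quad H^{(4)}_k=f_kT^{xy}_{k+1}\mathbb EB_k,$$ by $$\begin{aligned} S^x_k&=a_k^2S^x_{k+1}\big[1-S^x_{k+1}\mathbb EB_k(W^{(1)}_k)^{-1}\mathbb EB_k^T\big],& T^x_k&=a_k^2T^x_{k+1}\big[1-T^x_{k+1}\mathbb EB_k(W^{(2)}_k)^{-1}\mathbb EB_k^T\big],\\ S^{xy}_k&=a_kf_kS^{xy}_{k+1}\big[1-S^x_{k+1}\mathbb EB_k(W^{(1)}_k)^{-1}\mathbb EB_k^T\big],& T^{xy}_k&=a_kf_kT^{xy}_{k+1}\big[1-T^x_{k+1}\mathbb EB_k(W^{(2)}_k)^{-1}\mathbb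 EB_k^T\big],\\ S^y_k&=f_k^2\big[S^y_{k+1}-(S^{xy}_{k+1})^2\mathbb EB_k(W^{(1)}_k)^{-1}\mathbb EB_k^T\big],& T^y_k&=f_k^2\big[T^y_{k+1}-(T^{xy}_{k+1})^2\mathbb EB_k(W^{(2)}_k)^{-1}\mathbb EB_k^T\big]. \end{aligned}$$ Then for any square-integrable initial values $\zeta^x,\zeta^y$ the unique minimizer of $J(\zeta^x,\zeta^y,u)$ over $u\in\mathcal U_{ad}$ is $$u^o_k=-(W^{(1)}_k)^{-1}(H^{(1)}_k)^T(x_k-\mathbb Ex_k)-(W^{(2)}_k)^{-1}(H^{(2)}_k)^T\mathbb Ex_k-(W^{(1)}_k)^{-1}(H^{(3)}_k)^T(y_k-\mathbb Ey_k)-(W^{(2)}_k)^{-1}(H^{(4)}_k)^T\mathbb Ey_k,$$ $k=0,\dots,N-1$. Under this strategy the optimal value of the cost functional is $$J(\zeta^x,\zeta^y,u^o)=\mathbb E\big[S^x_0(\zeta^x-\mathbb E\zeta^x)^2+T^x_0(\mathbb E\zeta^x)^2+2S^{xy}_0(\zeta^x-\mathbb E\zeta^x)(\zeta^y-\mathbb E\zeta^y)+2T^{xy}_0\,\mathbb E\zeta^x\,\mathbb E\zeta^y+S^y_0(\zeta^y-\mathbb E\zeta^y)^2+T^y_0(\mathbb E\zeta^y)^2\big],$$ and $$\mathbb E(x_N-y_N)=\Big(\prod_{k=0}^{N-1}N_k\Big)\mathbb E\zeta^x+\Big(\sum_{k=0}^{N-1}\Big(\prod_{j=k+1}^{N-1}N_j\Big)M_k\Big(\prod_{j=0}^{k-1}f_j\Big)-\prod_{k=0}^{N-1}f_k\Big)\mathbb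 E\zeta^y,$$ where $$N_k=a_k\big(1-T^x_{k+1}\mathbb EB_k(W^{(2)}_k)^{-1}\mathbb EB_k^T\big),\qquad M_k=-f_kT^{xy}_{k+1}\mathbb EB_k(W^{(2)}_k)^{-1}\mathbb EB_k^T .$$ (Empty products equal $1$.)
   Context: $N$ is a positive integer (the time horizon) and $\mathbb E$ denotes expectation. A market has $m$ risky assets, one risk-free asset and one loan product. For $k=0,\dots,N-1$: $a_k,f_k\in\mathbb R$ are given deterministic numbers (risk-free return and loan repayment rate); $B_k=(B_k^1,\dots,B_k^m)$ is a square-integrable random row vector of excess returns, with mean $\mathbb EB_k\in\mathbb R^{1\times m}$, $\mathbb EB_k^T:=(\mathbb EB_k)^T$, and covariance matrix $\mathrm{Cov}(B_k)=\mathbb E(B_k^TB_k)-\mathbb EB_k^T\,\mathbb EB_k\in\mathbb R^{m\times m}$; the vectors $B_0,\dots,B_{N-1}$ are statistically independent. $\zeta^x,\zeta^y$ are square-integrable real random variables. Put $w_k=(B_k-\mathbb EB_k)^T$ and let $\mathcal F'_k$ be the information at the beginning of period $k$, i.e. the $\sigma$-algebra generated by $\zeta^x,\zeta^y,w_0,\dots,w_{k-1}$; it is assumed that $\mathbb E[w_k|\mathcal F'_k]=0$ and $\mathbb E[w_kw_k^T|\mathcal F'_k]=\mathrm{Cov}(B_k)$. The asset $x_k$ and liability $y_k$ (real-valued) evolve, for $k=0,\dots,N-1$, by $$x_{k+1}=a_kx_k+B_ku_k,\qquad y_{k+1}=f_ky_k,\qquad x_0=\zeta^x,\ y_0=\zeta^y,$$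 where $u_k\in\mathbb R^m$ is the vector of amounts invested in the risky assets. The cost functional is $$J(\zeta^x,\zeta^y,u)=\sum_{k=0}^{N-1}\mathbb E(u_k^TR_ku_k)+\mathbb E\big(q_N(x_N-y_N)^2\big)+\bar q_N\big(\mathbb E(x_N-y_N)\big)^2,$$ with deterministic symmetric $R_k\in\mathbb R^{m\times m}$ and $q_N,\bar q_N\in\mathbb R$; $R_k>0$ means positive definite. The admissible set $\mathcal U_{ad}$ consists of all $u=(u_0,\dots,u_{N-1})$ with $u_k$ an $\mathbb R^m$-valued $\mathcal F'_k$-measurable random vector and $\mathbb E|u_k|^2<\infty$; controls are identified when almost surely equal. *)

(* Defs.v *)
From HB Require Import structures.
From mathcomp Require Import all_boot all_order all_algebra.
From mathcomp Require Import all_classical all_reals all_analysis.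

Set Implicit Arguments.
Unset Strict Implicit.
Unset Printing Implicit Defensive.

Import Order.TTheory GRing.Theory Num.Theory.

Local Open Scope classical_set_scope.
Local Open Scope ring_scope.

Definition posdefmx (R : realType) (m : nat) (M : 'M[R]_m) : Prop :=
  forall v : 'cV[R]_m, v != 0 -> 0 < (v^T *m M *m v) 0 0.

Section probability_notions.
Context (R : realType) (d : measure_display) (Omega : measurableType d)
        (P : probability Omega R).

(* [fine] sends infinite values to 0: meaningful for integrable variables. *)
Definition Er (X : Omega -> R) : R := fine ('E_P[X])%E.

Definition Emx (p q : nat) (X : Omega -> 'M[R]_(p, q)) : 'M[R]_(p, q) :=
  \matrix_(i, j) Er (fun t => X t i j).

Definition Covmx (m : nat) (X : Omega -> 'rV[R]_m) : 'M[R]_m :=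
  Emx (fun t => (X t)^T *m X t) - (Emx X)^T *m Emx X.

(* Throughout, a sigma-algebra <<s G>> on Omega is represented by a generating
   family G. *)
Definition generators (X : Omega -> R) : set (set Omega) :=
  preimage_set_system setT X measurable.

Definition row_generators (m : nat) (X : Omega -> 'rV[R]_m) :
    set (set Omega) :=
  \bigcup_(j in [set: 'I_m]) generators (fun t => X t 0 j).

Definition measurable_wrt (G : set (set Omega)) (X : Omega -> R) : Prop :=
  measurable_fun [set: g_sigma_algebraType G] (X : g_sigma_algebraType G -> R).

(* Y is a version of the conditional expectation of X given <<s G>>. *)
Definition is_cond_exp (G : set (set Omega)) (X Y : Omega -> R) : Prop :=
  [/\ P.-integrable setT (EFin \o X),
      measurable_wrt G Y,
      P.-integrable setT (EFin \o Y) &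
      forall A, <<s G >> A ->
        (\int[P]_(t in A) (X t)%:E = \int[P]_(t in A) (Y t)%:E)%E].

Definition independent_rows (N m : nat) (X : nat -> Omega -> 'rV[R]_m) : Prop :=
  forall (I : {set 'I_N}) (E : 'I_N -> set Omega),
    (forall k, k \in I -> <<s row_generators (X k) >> (E k)) ->
    P (\bigcap_(k in [set` I]) E k) = (\prod_(k in I) fine (P (E k)))%:E.

End probability_notions.

Section asset_liability_model.
Context (R : realType) (d : measure_display) (Omega : measurableType d)
        (P : probability Omega R) (m : nat).

Definition noise (B : nat -> Omega -> 'rV[R]_m) (k : nat) (t : Omega) :
    'cV[R]_m :=
  (B k t - Emx P (B k))^T.

Definition info (B : nat -> Omega -> 'rV[R]_m) (zx zy : Omega -> R) (k : nat) :
    set (set Omega) :=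
  generators zx `|` generators zy
  `|` \bigcup_(l in [set l | (l < k)%N])
        row_generators (fun t => (noise B l t)^T).

Definition admissible (N : nat) (B : nat -> Omega -> 'rV[R]_m)
    (zx zy : Omega -> R) (u : nat -> Omega -> 'cV[R]_m) : Prop :=
  forall k, (k < N)%N ->
    (forall i, measurable_wrt (info B zx zy k) (fun t => u k t i 0)) /\
    ('E_P[fun t => (\sum_i u k t i 0 ^+ 2)%R] < +oo)%E.

Fixpoint asset (a : nat -> R) (B : nat -> Omega -> 'rV[R]_m) (zx : Omega -> R)
    (u : nat -> Omega -> 'cV[R]_m) (k : nat) (t : Omega) : R :=
  if k is l.+1 then a l * asset a B zx u l t + (B l t *m u l t) 0 0 else zx t.

Fixpoint liability (f : nat -> R) (zy : Omega -> R) (k : nat) (t : Omega) : R :=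
  if k is l.+1 then f l * liability f zy l t else zy t.

(* The cost takes values in the extended reals; it is finite on admissible
   controls. *)
Definition cost (N : nat) (a f : nat -> R) (B : nat -> Omega -> 'rV[R]_m)
    (Rw : nat -> 'M[R]_m) (qN qbarN : R) (zx zy : Omega -> R)
    (u : nat -> Omega -> 'cV[R]_m) : \bar R :=
  let z t := asset a B zx u N t - liability f zy N t in
  (\sum_(k < N) 'E_P[fun t => (((u k t)^T *m Rw k *m u k t) 0 0)%R]
   + 'E_P[fun t => (qN * z t ^+ 2)%R]
   + qbarN%:E * 'E_P[z] ^+ 2)%E.

Definition is_minimizer (N : nat) (a f : nat -> R)
    (B : nat -> Omega -> 'rV[R]_m) (Rw : nat -> 'M[R]_m) (qN qbarN : R)
    (zx zy : Omega -> R) (u : nat -> Omega -> 'cV[R]_m) : Prop :=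
  admissible N B zx zy u /\
  forall v, admissible N B zx zy v ->
    (cost N a f B Rw qN qbarN zx zy u <= cost N a f B Rw qN qbarN zx zy v)%E.

End asset_liability_model.

(* Main.v *)
Require Import Defs.
From HB Require Import structures.
From mathcomp Require Import all_boot all_order all_algebra.
From mathcomp Require Import all_classical all_reals all_analysis.
From mathcomp Require Import measurable_realfun ring lra.

Set Implicit Arguments.
Unset Strict Implicit.
Unset Printing Implicit Defensive.

Import Order.TTheory GRing.Theory Num.Theory.

Local Open Scope classical_set_scope.
Local Open Scope ring_scope.

(* Split the asset and the liability into mean and centered parts, and let
   [value_at u k] be the quadratic form in these parts with coefficients
   [Sx k], ..., [Ty k].  The noise is orthogonal to the past with constant
   conditional covariance, so completing the square twice (with [W1] for the
   centered part of the control, with [W2] for its mean) gives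
     E(u_k' R_k u_k) + value_at u k.+1 = value_at u k + loss u k,
   where [loss u k] is the sum of a [W1]- and a [W2]-quadratic form in the
   deviation of [u k] from the feedback law.  Telescoping,
   cost u = value_at u 0 + sum_k (loss u k); the first term does not depend on
   [u], and each loss is nonnegative and vanishes exactly when [u k] is almost
   surely the feedback. *)

(** * Expectation of real random variables *)

(** The obstacle is integrability. A product of two square-integrable variables is in general only
    integrable, so neither the noise term of the asset nor its products with the past are controlled
    for free. The constant conditional second moment of the noise helps: it makes each control
    component times the matching noise component square-integrable. Conditional expectations are
    given only through integrals over sets of the generated sigma-algebra, so pulling out measurable
    factors has to be established as well, and for nonnegative functions it is needed with infinite
    values allowed. Completing the squares requires [W1] and [W2] to be invertible. Only [Sx] and
    [Tx] enter these matrices, so nonnegativity of these two coefficients, propagated backward in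
    time, is all that positive definiteness asks for. Each loss compares a control with the feedback
    computed from the state which that same control produces. Zero loss therefore does not identify
    a minimizer at once: its states must be matched with the optimal ones, forward in time. *)

Section expectation_calculus.
Context (R : realType) (d : measure_display) (Omega : measurableType d)
        (P : probability Omega R).
Implicit Types (X Y : Omega -> R) (c : R).

Lemma Lfun_measurable (p : \bar R) X :
  X \in Lfun P p -> measurable_fun setT X.
Proof. by rewrite inE => /andP[+ _]; rewrite inE. Qed.

Lemma Lfun2_Lfun1 X : X \in Lfun P 2%:E -> X \in Lfun P 1%E.
Proof. by apply: Lfun_subset12; exact: fin_num_measure. Qed.

Lemma LfunD (p : \bar R) (p1 : (1 <= p)%E) X Y :
  X \in Lfun P p -> Y \in Lfun P p -> (fun t => X t + Y t) \in Lfun P p.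
Proof. by move=> hX hY; have [_ h] := Lfun_addr_closed P p1; exact: h. Qed.

Lemma LfunZ (p : R) (p1 : 1 <= p) c X :
  X \in Lfun P p%:E -> (fun t => c * X t) \in Lfun P p%:E.
Proof.
move=> /(Lfun_scale c p1); suff -> : c \o* X = (fun t => c * X t) by [].
by apply/funext => t /=; rewrite mulrC.
Qed.

Lemma Lfun_const (p : R) c : (fun=> c) \in Lfun P p%:E.
Proof. exact: Lfun_cst. Qed.

Lemma LfunN (p : R) (p1 : 1 <= p) X :
  X \in Lfun P p%:E -> (fun t => - X t) \in Lfun P p%:E.
Proof.
by move=> /(LfunZ p1 (-1)); under eq_fun do rewrite mulN1r.
Qed.

Lemma LfunB (p : R) (p1 : 1 <= p) X Y :
  X \in Lfun P p%:E -> Y \in Lfun P p%:E -> (fun t => X t - Y t) \in Lfun P p%:E.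
Proof. by move=> hX /(LfunN p1); exact: LfunD. Qed.

Lemma Lfun_sum (p : R) (p1 : 1 <= p) (I : Type) (s : seq I) (F : I -> Omega -> R) :
  (forall i, F i \in Lfun P p%:E) ->
  (fun t => \sum_(i <- s) F i t) \in Lfun P p%:E.
Proof.
move=> hF; elim: s => [|i s ih].
  by under eq_fun do rewrite big_nil; exact: Lfun_const.
by under eq_fun do rewrite big_cons; apply: LfunD.
Qed.

Lemma Lfun1_mul X Y :
  X \in Lfun P 2%:E -> Y \in Lfun P 2%:E -> (fun t => X t * Y t) \in Lfun P 1%E.
Proof. exact: Lfun2_mul_Lfun1. Qed.

Lemma Lfun1_sqr X :
  X \in Lfun P 2%:E -> (fun t => X t ^+ 2) \in Lfun P 1%E.
Proof. by move=> hX; under eq_fun do rewrite expr2; exact: Lfun1_mul. Qed.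

Lemma Lfun2_of_sqr X : measurable_fun setT X ->
  ('E_P[fun t => (X t ^+ 2)%R] < +oo)%E -> X \in Lfun P 2%:E.
Proof.
move=> mX hX; rewrite inE; apply/andP; split; rewrite inE//=.
rewrite /finite_norm unlock /= poweR_lty//.
move: hX; rewrite unlock; congr (_ < _)%E; apply: eq_integral => t _.
by rewrite powR_mulrn// real_normK// num_real.
Qed.

Lemma ErE X : X \in Lfun P 1%E -> 'E_P[X]%E = (Er P X)%:E.
Proof. by move=> hX; rewrite fineK//; exact: expectation_fin_num. Qed.

Lemma ErD X Y : X \in Lfun P 1%E -> Y \in Lfun P 1%E ->
  Er P (fun t => X t + Y t) = Er P X + Er P Y.
Proof. by move=> hX hY; rewrite /Er expectationD// !ErE. Qed.

Lemma ErZ c X : X \in Lfun P 1%E -> Er P (fun t => c * X t) = c * Er P X.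
Proof.
move=> hX; transitivity (fine 'E_P[c \o* X]).
  by congr (fine 'E_P[_]); apply/funext => t /=; rewrite mulrC.
by rewrite expectationZl// ErE.
Qed.

Lemma Er_cst c : Er P (fun=> c) = c.
Proof. by rewrite /Er (expectation_cst P c). Qed.

Lemma ErN X : X \in Lfun P 1%E -> Er P (fun t => - X t) = - Er P X.
Proof. by move=> hX; under eq_fun do rewrite -mulN1r; rewrite ErZ// mulN1r. Qed.

Lemma ErB X Y : X \in Lfun P 1%E -> Y \in Lfun P 1%E ->
  Er P (fun t => X t - Y t) = Er P X - Er P Y.
Proof. by move=> hX hY; rewrite /Er expectationB// !ErE. Qed.

Lemma Er_sum (I : Type) (s : seq I) (F : I -> Omega -> R) :
  (forall i, F i \in Lfun P 1%E) ->
  Er P (fun t => \sum_(i <- s) F i t) = \sum_(i <- s) Er P (F i).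
Proof.
move=> hF; elim: s => [|i s ih].
  by under eq_fun do rewrite big_nil; rewrite Er_cst big_nil.
under eq_fun do rewrite big_cons; rewrite ErD ?ih ?big_cons//.
exact: (@Lfun_sum 1).
Qed.

(** An infinite expectation is sent to 0 by [fine], so the bound survives. *)
Lemma Er_ge0 X : (forall t, 0 <= X t) -> 0 <= Er P X.
Proof. by move=> hX; rewrite fine_ge0// expectation_ge0. Qed.

Lemma Er_ae_eq X Y : measurable_fun setT X -> measurable_fun setT Y ->
  {ae P, forall t, X t = Y t} -> Er P X = Er P Y.
Proof.
move=> mX mY h; rewrite /Er unlock; congr fine; apply: ae_eq_integral => //.
- exact/measurable_EFinP.
- exact/measurable_EFinP.
- by apply: filterS h => t /= ->.
Qed.

Lemma Er_ge0_eq0 X : X \in Lfun P 1%E -> (forall t, 0 <= X t) -> Er P X = 0 ->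
  {ae P, forall t, X t = 0}.
Proof.
move=> hX X0 h0.
have mX : measurable_fun setT (EFin \o X).
  by apply/measurable_EFinP; apply: Lfun_measurable hX.
have : (\int[P]_t `|(EFin \o X) t| = 0)%E.
  rewrite -[RHS](congr1 EFin h0) -ErE// unlock.
  by apply: eq_integral => t _ /=; rewrite ger0_norm.
move/(ae_eq_integral_abs P measurableT mX); apply: filterS => t /= /(_ I) [].
by [].
Qed.

End expectation_calculus.

(** * Pulling out measurable factors *)

Import HBNNSimple.

Section pull_out.
Context (R : realType) (d : measure_display) (Omega : measurableType d)
        (P : probability Omega R).
Variable G : set (set Omega).
Hypothesis Gm : G `<=` measurable.
Implicit Types X Y g h : Omega -> R.

Lemma generated_measurable : <<s G >> `<=` @measurable _ Omega.
Proof. exact: smallest_sub (@sigma_algebra_measurable _ Omega) Gm. Qed.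

Lemma measurable_wrtW X : measurable_wrt G X -> measurable_fun setT X.
Proof.
move=> mX _ A mA; apply: generated_measurable.
by have := mX measurableT A mA.
Qed.

(** Both sides may be infinite, which matters below, where finiteness is what has to be proved.
    Approximating [g] from below by simple functions, monotone convergence reduces the claim to
    level sets, where it is the assumption on [X] and [Y]. *)
Lemma ge0_pull_out X Y g :
  measurable_fun setT X -> measurable_fun setT Y ->
  (forall t, 0 <= X t) -> (forall t, 0 <= Y t) ->
  (forall A, <<s G >> A ->
     (\int[P]_(t in A) (X t)%:E = \int[P]_(t in A) (Y t)%:E)%E) ->
  measurable_wrt G g -> (forall t, 0 <= g t) ->
  (\int[P]_t (g t * X t)%:E = \int[P]_t (g t * Y t)%:E)%E.
Proof.
move=> mX mY X0 Y0 XY mg g0.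
have mEg : measurable_fun [set: g_sigma_algebraType G]
    (EFin \o g : g_sigma_algebraType G -> \bar R).
  exact/measurable_EFinP.
(* The approximation lives on the space that carries [<<s G>>], so the level sets of [hn n] belong
   to [<<s G>>]; [gn] is the same function read on [Omega]. *)
pose hn := nnsfun_approx measurableT mEg.
pose gn n : Omega -> R := (hn n : g_sigma_algebraType G -> R).
have mgn n : measurable_fun [set: Omega] (gn n).
  apply: measurable_wrtW; rewrite /measurable_wrt.
  exact: (@measurable_funPT _ _ _ _ (hn n)).
have mlevel n r : <<s G >> (gn n @^-1` [set r]).
  have := @measurable_funPT _ _ _ _ (hn n) measurableT _ (measurable_set1 r).
  by rewrite setTI.
have gn0 n t : 0 <= gn n t by exact: fun_ge0.
have key (Z : Omega -> R) : measurable_fun setT Z -> (forall t, 0 <= Z t) ->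
    (\int[P]_t (g t * Z t)%:E = limn (fun n => \int[P]_t (gn n t * Z t)%:E))%E.
  move=> mZ Z0; rewrite -monotone_convergence//; last 3 first.
  - by move=> n; apply/measurable_EFinP; exact: measurable_funM.
  - by move=> n t _; rewrite lee_fin mulr_ge0.
  - move=> t _ i j ij; rewrite lee_fin ler_wpM2r//.
    by have /lefP := nd_nnsfun_approx measurableT mEg ij; apply.
  apply: eq_integral => t _; apply/esym/cvg_lim => //.
  apply: (@cvg_trans _ ((gn n t)%:E * (Z t)%:E @[n --> \oo])%E).
    by under eq_fun do rewrite EFinM; exact: cvg_refl.
  rewrite EFinM; apply: cvgeZr => //.
  by apply: (@cvg_nnsfun_approx _ _ _ _ measurableT _ mEg) => // s _; rewrite lee_fin.
rewrite (key X)// (key Y)//; congr (limn _); apply/funext => n.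
have simple (Z : Omega -> R) : measurable_fun setT Z -> (forall t, 0 <= Z t) ->
    (\int[P]_t (gn n t * Z t)%:E =
      let s := finmap.enum_fset (fset_set (range (gn n))) in
      \sum_(i < size s) (s`_i)%:E * \int[P]_(t in gn n @^-1` [set s`_i]) (Z t)%:E)%E.
  move=> mZ Z0 /=; set s := finmap.enum_fset _.
  have s0 (i : 'I_(size s)) : 0 <= s`_i.
    have : s`_i \in s by exact: mem_nth.
    rewrite /s in_fset_set; last exact: (@fimfunP _ _ (hn n)).
    by rewrite inE => -[t _ <-].
  have mA (i : 'I_(size s)) : measurable (gn n @^-1` [set s`_i] : set Omega).
    exact: generated_measurable.
  (* On each of its level sets [gn n] is constant, so the integrand is a finite sum of multiples of
     restrictions of [Z]. *)
  transitivity (\int[P]_t (\sum_(i < size s)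
      (s`_i)%:E * ((fun t => (Z t)%:E) \_ (gn n @^-1` [set s`_i])) t))%E.
    apply: eq_integral => t _; rewrite {1}/gn (fimfunEord (hn n)) mulr_suml -sumEFin.
    by apply: eq_bigr => i _; rewrite epatch_indic /= -mulrA EFinM EFinM (muleC (Z t)%:E).
  have mZA (i : 'I_(size s)) : measurable_fun setT
      ((fun t => (Z t)%:E) \_ (gn n @^-1` [set s`_i])).
    apply/(measurable_restrictT _ (mA i)).1; apply: measurable_funTS.
    exact/measurable_EFinP.
  have ZA0 (i : 'I_(size s)) t :
      (0 <= ((fun t => (Z t)%:E) \_ (gn n @^-1` [set s`_i])) t)%E.
    by apply: erestrict_ge0 => ? _; rewrite lee_fin.
  rewrite ge0_integral_sum//.
  - apply: eq_bigr => i _; rewrite ge0_integralZl_EFin// ?s0//.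
    by rewrite -integral_mkcond.
  - by move=> i; apply: measurable_funeM.
  - by move=> i t _; rewrite mule_ge0// lee_fin.
rewrite (simple X)// (simple Y)//=; apply: eq_bigr => i _; congr (_ * _)%E.
exact: XY.
Qed.

Lemma measurable_wrt_cst (c : R) : measurable_wrt G (fun=> c).
Proof. exact: (@measurable_cst _ _ (g_sigma_algebraType G)). Qed.

Lemma measurable_wrtD X Y : measurable_wrt G X -> measurable_wrt G Y ->
  measurable_wrt G (fun t => X t + Y t).
Proof. exact: (@measurable_funD _ (g_sigma_algebraType G)). Qed.

Lemma measurable_wrtM X Y : measurable_wrt G X -> measurable_wrt G Y ->
  measurable_wrt G (fun t => X t * Y t).
Proof. exact: (@measurable_funM _ (g_sigma_algebraType G)). Qed.

Lemma measurable_wrtN X : measurable_wrt G X -> measurable_wrt G (fun t => - X t).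
Proof.
by move=> /(measurable_wrtM (measurable_wrt_cst (-1))); under eq_fun do rewrite mulN1r.
Qed.

Lemma measurable_wrtB X Y : measurable_wrt G X -> measurable_wrt G Y ->
  measurable_wrt G (fun t => X t - Y t).
Proof. by move=> hX /measurable_wrtN; exact: measurable_wrtD. Qed.

Lemma measurable_wrt_norm X : measurable_wrt G X ->
  measurable_wrt G (fun t => `|X t|).
Proof. exact: (@measurableT_comp _ _ _ (g_sigma_algebraType G)). Qed.

Lemma measurable_wrt_sum (I : Type) (s : seq I) (F : I -> Omega -> R) :
  (forall i, measurable_wrt G (F i)) ->
  measurable_wrt G (fun t => \sum_(i <- s) F i t).
Proof.
move=> hF; elim: s => [|i s ih].
  by under eq_fun do rewrite big_nil; exact: measurable_wrt_cst.
by under eq_fun do rewrite big_cons; apply: measurable_wrtD.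
Qed.

Lemma Lfun1_norm X : X \in Lfun P 1%E -> (fun t => `|X t|) \in Lfun P 1%E.
Proof. exact: Lfun_norm. Qed.

(* Adding [`|X| + `|Y|] to both [X] and [Y] makes them nonnegative. *)
Lemma pull_out_ge0 X Y g :
  X \in Lfun P 1%E -> Y \in Lfun P 1%E ->
  (forall A, <<s G >> A ->
     (\int[P]_(t in A) (X t)%:E = \int[P]_(t in A) (Y t)%:E)%E) ->
  measurable_wrt G g -> (forall t, 0 <= g t) ->
  (fun t => g t * X t) \in Lfun P 1%E -> (fun t => g t * Y t) \in Lfun P 1%E ->
  Er P (fun t => g t * X t) = Er P (fun t => g t * Y t).
Proof.
move=> hX hY XY mg g0 hgX hgY.
pose S t := `|X t| + `|Y t|.
have hS : S \in Lfun P 1%E by apply: LfunD => //; exact: Lfun1_norm.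
have hSD Z : Z \in Lfun P 1%E -> (fun t => S t + Z t) \in Lfun P 1%E by exact: LfunD.
have SX0 t : 0 <= S t + X t.
  by rewrite /S; have := ler_norm (- X t); have := normr_ge0 (Y t); rewrite normrN; lra.
have SY0 t : 0 <= S t + Y t.
  by rewrite /S; have := ler_norm (- Y t); have := normr_ge0 (X t); rewrite normrN; lra.
(* Since [g] is nonnegative it moves inside the absolute values, so the two given integrable
   products already dominate. *)
have hgS : (fun t => g t * S t) \in Lfun P 1%E.
  have -> : (fun t => g t * S t) = (fun t => `|g t * X t| + `|g t * Y t|).
    by apply/funext => t; rewrite !normrM (ger0_norm (g0 t)) mulrDr.
  by apply: LfunD => //; exact: Lfun1_norm.
have : Er P (fun t => g t * (S t + X t)) = Er P (fun t => g t * (S t + Y t)).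
  rewrite /Er unlock; congr fine; apply: ge0_pull_out => //.
  - exact: Lfun_measurable (hSD _ hX).
  - exact: Lfun_measurable (hSD _ hY).
  - move=> A sA; have mA := generated_measurable sA.
    have iA Z : Z \in Lfun P 1%E -> P.-integrable A (EFin \o Z).
      by move=> /Lfun1_integrable; apply: integrableS.
    rewrite !integralD_EFin ?iA//; try exact: Lfun1_norm.
    by congr (_ + _)%E; exact: XY.
under eq_fun do rewrite mulrDr; under [in RHS]eq_fun do rewrite mulrDr.
by rewrite !ErD// => /addrI.
Qed.

(** A signed [g] is the difference of the nonnegative factors [|g| + g] and [|g|], both measurable
    for [<<s G>>]. *)
Lemma pull_out X Y g : is_cond_exp P G X Y -> measurable_wrt G g ->
  (fun t => g t * X t) \in Lfun P 1%E -> (fun t => g t * Y t) \in Lfun P 1%E ->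
  Er P (fun t => g t * X t) = Er P (fun t => g t * Y t).
Proof.
case=> /Lfun1_integrable hX _ /Lfun1_integrable hY XY mg hgX hgY.
have hn Z : (fun t => g t * Z t) \in Lfun P 1%E -> Z \in Lfun P 1%E ->
    (fun t => `|g t| * Z t) \in Lfun P 1%E.
  move=> hgZ hZ; apply/Lfun1_integrable.
  apply: (le_integrable measurableT) (iffLR (Lfun1_integrable _ _) hgZ).
    apply/measurable_EFinP; apply: measurable_funM; last exact: Lfun_measurable hZ.
    by apply: measurable_wrtW; exact: measurable_wrt_norm.
  by move=> t _ /=; rewrite lee_fin !normrM normr_id.
have h1 := pull_out_ge0 hX hY XY (measurable_wrt_norm mg) (fun t => normr_ge0 _)
  (hn _ hgX hX) (hn _ hgY hY).
have split Z t : (`|g t| + g t) * Z t = `|g t| * Z t + g t * Z t by rewrite mulrDl.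
have hs Z : (fun t => g t * Z t) \in Lfun P 1%E -> Z \in Lfun P 1%E ->
    (fun t => (`|g t| + g t) * Z t) \in Lfun P 1%E.
  by move=> hgZ hZ; under eq_fun do rewrite split; apply: LfunD => //; exact: hn.
have g0 t : 0 <= `|g t| + g t by have := ler_norm (- g t); rewrite normrN; lra.
have := pull_out_ge0 hX hY XY (measurable_wrtD (measurable_wrt_norm mg) mg) g0
  (hs _ hgX hX) (hs _ hgY hY).
under eq_fun do rewrite split; under [in RHS]eq_fun do rewrite split.
by rewrite !ErD ?hn// h1 => /addrI.
Qed.

(** Conditioning turns the second moment of [g * X] into [c] times that of [g]. The nonnegative
    version of pulling out applies, since finiteness is not yet known. *)
Lemma Lfun2_mul_cond_sqr g X (c : R) :
  measurable_wrt G g -> g \in Lfun P 2%:E -> measurable_fun setT X ->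
  is_cond_exp P G (fun t => X t * X t) (cst c) ->
  (fun t => g t * X t) \in Lfun P 2%:E.
Proof.
move=> mg hg mX [/Lfun1_integrable hX _ _ XY].
have c0 : 0 <= c.
  have : Er P (fun t => X t * X t) = Er P (fun=> c).
    by rewrite /Er unlock (XY setT)//; exact: (@measurableT _ (g_sigma_algebraType G)).
  by rewrite Er_cst => <-; apply: Er_ge0 => t; rewrite -expr2 sqr_ge0.
apply: Lfun2_of_sqr; first by apply: measurable_funM => //; exact: measurable_wrtW.
rewrite unlock.
have -> : (\int[P]_t ((g t * X t) ^+ 2)%:E = \int[P]_t ((g t * g t) * c)%:E)%E.
  transitivity (\int[P]_t ((g t * g t) * (X t * X t))%:E)%E.
    by apply: eq_integral => t _; rewrite expr2 mulrACA.
  apply: ge0_pull_out => //.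
  - exact: measurable_funM.
  - by move=> t; rewrite -expr2 sqr_ge0.
  - exact: measurable_wrtM.
  - by move=> t; rewrite -expr2 sqr_ge0.
apply: integrable_lty => //; apply/Lfun1_integrable.
under eq_fun do rewrite mulrC.
by apply: (@LfunZ _ _ _ _ 1) => //; exact: Lfun1_mul.
Qed.

(** * Moments of the noise term *)

Section noise.
Variables (m : nat) (C : 'M[R]_m) (w : Omega -> 'cV[R]_m).
Hypothesis mean_w : forall i, is_cond_exp P G (fun t => w t i 0) (cst 0).
Hypothesis cov_w : forall i j,
  is_cond_exp P G (fun t => (w t *m (w t)^T) i j) (cst (C i j)).

Let cov_wE i j : is_cond_exp P G (fun t => w t i 0 * w t j 0) (cst (C i j)).
Proof.
have := cov_w i j.
by under eq_fun do rewrite mxE big_ord1 !mxE.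
Qed.

Let Lfun1_w i : (fun t => w t i 0) \in Lfun P 1%E.
Proof. by have [/Lfun1_integrable] := mean_w i. Qed.

Variable u : Omega -> 'cV[R]_m.
Hypothesis mu : forall i, measurable_wrt G (fun t => u t i 0).
Hypothesis hu : forall i, (fun t => u t i 0) \in Lfun P 2%:E.

Let Lfun2_uw i : (fun t => u t i 0 * w t i 0) \in Lfun P 2%:E.
Proof.
by apply: Lfun2_mul_cond_sqr (cov_wE i i) => //; exact: Lfun_measurable (Lfun1_w i).
Qed.

Let noiseE t : ((w t)^T *m u t) 0 0 = \sum_i u t i 0 * w t i 0.
Proof. by rewrite mxE; apply: eq_bigr => i _; rewrite mxE mulrC. Qed.

Lemma Lfun2_noise : (fun t => ((w t)^T *m u t) 0 0) \in Lfun P 2%:E.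
Proof.
under eq_fun do rewrite noiseE; apply: Lfun_sum => //.
by rewrite ler1n.
Qed.

Lemma Er_mul_noise h : measurable_wrt G h -> h \in Lfun P 2%:E ->
  Er P (fun t => h t * ((w t)^T *m u t) 0 0) = 0.
Proof.
move=> mh hh.
have hi i : (fun t => h t * (u t i 0 * w t i 0)) \in Lfun P 1%E by exact: Lfun1_mul.
transitivity (Er P (fun t => \sum_i h t * (u t i 0 * w t i 0))).
  by congr (Er P _); apply/funext => t; rewrite noiseE mulr_sumr.
rewrite Er_sum// big1// => i _.
(* The factor pulled out is [h t * u t i 0]: it is only integrable, but its product with the noise
   is integrable by the other grouping, [h] times the square-integrable [u t i 0 * w t i 0]. *)
under eq_fun do rewrite mulrA.
rewrite (pull_out (mean_w i)).
- by under eq_fun do rewrite mulr0; exact: Er_cst.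
- exact: measurable_wrtM.
- by under eq_fun do rewrite -mulrA.
- by under eq_fun do rewrite mulr0; exact: Lfun_const.
Qed.

Lemma Er_noise : Er P (fun t => ((w t)^T *m u t) 0 0) = 0.
Proof.
rewrite -(Er_mul_noise (measurable_wrt_cst 1)); last exact: Lfun_const.
by under [in RHS]eq_fun do rewrite mul1r.
Qed.

Lemma Er_noise_sqr :
  Er P (fun t => ((w t)^T *m u t) 0 0 ^+ 2)
  = Er P (fun t => ((u t)^T *m C *m u t) 0 0).
Proof.
(* Four factors are integrable because they regroup into two square-integrable products, one for [i]
   and one for [j]. *)
have hij i j : (fun t => (u t i 0 * u t j 0) * (w t i 0 * w t j 0)) \in Lfun P 1%E.
  by under eq_fun do rewrite mulrACA; exact: Lfun1_mul.
have huC i j : (fun t => (u t i 0 * u t j 0) * C i j) \in Lfun P 1%E.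
  under eq_fun do rewrite mulrC.
  by apply: (@LfunZ _ _ _ _ 1) => //; exact: Lfun1_mul.
transitivity (\sum_i \sum_j Er P (fun t => (u t i 0 * u t j 0) * (w t i 0 * w t j 0))).
  under [in RHS]eq_bigr do rewrite -Er_sum//.
  rewrite -Er_sum; last by move=> i; exact: (@Lfun_sum _ _ _ _ 1).
  congr (Er P _); apply/funext => t; rewrite noiseE expr2 mulr_suml.
  by apply: eq_bigr => i _; rewrite mulr_sumr; apply: eq_bigr => j _; rewrite mulrACA.
transitivity (\sum_i \sum_j Er P (fun t => (u t i 0 * u t j 0) * C i j)).
  apply: eq_bigr => i _; apply: eq_bigr => j _.
  by rewrite (pull_out (cov_wE i j))//; exact: measurable_wrtM.
under eq_bigr do rewrite -Er_sum//.
rewrite -Er_sum; last by move=> i; exact: (@Lfun_sum _ _ _ _ 1).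
congr (Er P _); apply/funext => t; rewrite exchange_big mxE/=.
apply: eq_bigr => j _; rewrite mxE mulr_suml; apply: eq_bigr => i _.
by rewrite mxE; ring.
Qed.

End noise.

End pull_out.

(** * Quadratic forms *)

Section quadratic_forms.
Context (R : realType) (m : nat).
Implicit Types (W M : 'M[R]_m) (e : 'rV[R]_m) (v z : 'cV[R]_m).

Definition qform M v : R := (v^T *m M *m v) 0 0.

Lemma qformDm M1 M2 v : qform (M1 + M2) v = qform M1 v + qform M2 v.
Proof. by rewrite /qform mulmxDr mulmxDl mxE. Qed.

Lemma qformZm (c : R) M v : qform (c *: M) v = c * qform M v.
Proof. by rewrite /qform -scalemxAr -scalemxAl mxE. Qed.

Lemma qform_outer e v : qform (e^T *m e) v = (e *m v) 0 0 ^+ 2.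
Proof. by rewrite /qform mulmxA -mulmxA -trmx_mul mxE big_ord1 mxE expr2. Qed.

Lemma qformD M v z :
  qform M (v + z) = qform M v + (v^T *m M *m z) 0 0 + (z^T *m M *m v) 0 0 + qform M z.
Proof. by rewrite /qform [(v + z)^T]raddfD /= !mulmxDl !mulmxDr !mxE; ring. Qed.

Lemma qform_sum M v : qform M v = \sum_j \sum_i M i j * (v i 0 * v j 0).
Proof.
rewrite /qform mxE; apply: eq_bigr => j _; rewrite mxE mulr_suml.
by apply: eq_bigr => i _; rewrite mxE; ring.
Qed.

Lemma qformZ (c : R) M v : qform M (c *: v) = c ^+ 2 * qform M v.
Proof.
by rewrite /qform [(c *: v)^T]linearZ /= -scalemxAr -!scalemxAl scalerA mxE expr2.
Qed.

Lemma rowmulB e v z : (e *m (v - z)) 0 0 = (e *m v) 0 0 - (e *m z) 0 0.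
Proof. by rewrite mulmxBr !mxE. Qed.

(** The shift is a multiple of the solution of [W z = e^T], so [W] cancels from the cross terms and
    leaves [e v]: exactly the linear term that the dynamics produce. *)
Lemma complete_square W e v (c : R) : W^T = W -> W \in unitmx ->
  qform W (v + c *: (invmx W *m e^T)) =
  qform W v + 2 * c * (e *m v) 0 0 + c ^+ 2 * (e *m invmx W *m e^T) 0 0.
Proof.
move=> Wsym Wunit; set z := invmx W *m e^T.
have Wz : W *m z = e^T by rewrite /z mulKVmx.
have zW : z^T *m W = e by rewrite -{1}Wsym -trmx_mul Wz trmxK.
have vWz : (v^T *m W *m z) 0 0 = (e *m v) 0 0.
  by rewrite -mulmxA Wz -trmx_mul mxE.
have zWz : qform W z = (e *m invmx W *m e^T) 0 0 by rewrite /qform zW /z mulmxA.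
rewrite qformD qformZ zWz -scalemxAr [(c *: z)^T]linearZ /= -!scalemxAl zW.
by rewrite [(c *: (v^T *m W *m z)) 0 0]mxE [(c *: (e *m v)) 0 0]mxE vWz; ring.
Qed.

Lemma posdefmx_unitmx W : posdefmx W -> W \in unitmx.
Proof.
move=> Wpos; rewrite -row_free_unit -kermx_eq0; apply/negPn/negP => /rowV0Pn[v].
move=> /sub_kermxP vW v0.
suff /Wpos : v^T != 0 by rewrite trmxK vW mul0mx mxE ltxx.
by apply: contra v0 => /eqP h; rewrite -[v]trmxK h trmx0.
Qed.

Lemma posdefmx_ge0 W v : posdefmx W -> 0 <= qform W v.
Proof.
move=> Wpos; have [->|v0] := eqVneq v 0; last exact/ltW/Wpos.
by rewrite /qform mulmx0 mxE.
Qed.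

Lemma posdefmx_qform0 W v : posdefmx W -> qform W v = 0 -> v = 0.
Proof.
move=> Wpos qv; apply/eqP/negPn/negP => /Wpos.
by rewrite -/(qform W v) qv ltxx.
Qed.

Lemma posdefmxD W M : posdefmx W -> (forall v, 0 <= qform M v) -> posdefmx (W + M).
Proof.
move=> Wpos Mge0 v v0; rewrite -/(qform (W + M) v) qformDm.
by rewrite ltr_pwDl ?Mge0//; exact: Wpos.
Qed.

(* With [v := invmx W *m e^T], [b] is both [qform W v] and [e v], so the
   hypothesis on [W] gives [s * b ^+ 2 <= b]. *)
Lemma riccati_factor_ge0 W e (s : R) : W^T = W -> posdefmx W ->
  (forall v, s * (e *m v) 0 0 ^+ 2 <= qform W v) ->
  0 <= 1 - s * (e *m invmx W *m e^T) 0 0.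
Proof.
move=> Wsym Wpos hW; have Wunit := posdefmx_unitmx Wpos.
set z := invmx W *m e^T; set b := (_ *m e^T) 0 0.
have bE : (e *m z) 0 0 = b by rewrite /b /z mulmxA.
have qzE : qform W z = b by rewrite /qform -mulmxA mulKVmx// -trmx_mul mxE.
have := hW z; have := posdefmx_ge0 z Wpos; rewrite bE qzE => b0.
rewrite subr_ge0 expr2 mulrA; move: b0; rewrite le_eqVlt => /predU1P[<-|b0].
  by rewrite !mulr0 ler01.
by rewrite -[X in _ <= X -> _]mul1r ler_pM2r.
Qed.

End quadratic_forms.

(** * Expectations of linear and quadratic forms *)

Section quadratic_expectation.
Context (R : realType) (d : measure_display) (Omega : measurableType d)
        (P : probability Omega R) (m : nat).
Implicit Types (M : 'M[R]_m) (e : 'rV[R]_m) (u : Omega -> 'cV[R]_m).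

Lemma trmx_Emx (p q : nat) (X : Omega -> 'M[R]_(p, q)) :
  (Emx P X)^T = Emx P (fun t => (X t)^T).
Proof.
apply/matrixP => i j; rewrite !mxE; congr (Er P _).
by apply/funext => t; rewrite mxE.
Qed.

Lemma trmx_Covmx (X : Omega -> 'rV[R]_m) : (Covmx P X)^T = Covmx P X.
Proof.
rewrite /Covmx [LHS]raddfB /= trmx_mul trmxK trmx_Emx; congr (Emx P _ - _).
by apply/funext => t; rewrite trmx_mul trmxK.
Qed.

Lemma Lfun_rowmul (p : R) (p1 : 1 <= p) e u :
  (forall i, (fun t => u t i 0) \in Lfun P p%:E) ->
  (fun t => (e *m u t) 0 0) \in Lfun P p%:E.
Proof.
move=> hu; under eq_fun do rewrite mxE.
by apply: Lfun_sum => // i; exact: LfunZ.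
Qed.

Lemma Er_rowmul e u : (forall i, (fun t => u t i 0) \in Lfun P 1%E) ->
  Er P (fun t => (e *m u t) 0 0) = (e *m Emx P u) 0 0.
Proof.
move=> hu; under eq_fun do rewrite mxE.
rewrite Er_sum; last by move=> i; exact: (@LfunZ _ _ _ _ 1).
by rewrite mxE; apply: eq_bigr => i _; rewrite ErZ// mxE.
Qed.

Lemma Lfun1_qform M u : (forall i, (fun t => u t i 0) \in Lfun P 2%:E) ->
  (fun t => qform M (u t)) \in Lfun P 1%E.
Proof.
move=> hu; under eq_fun do rewrite qform_sum.
apply: (@Lfun_sum _ _ _ _ 1) => // j; apply: (@Lfun_sum _ _ _ _ 1) => // i.
by apply: (@LfunZ _ _ _ _ 1) => //; exact: Lfun1_mul.
Qed.

(** The cross terms are linear in the deviation from the mean, hence average to zero. *)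
Lemma Er_qform_center M u : (forall i, (fun t => u t i 0) \in Lfun P 2%:E) ->
  Er P (fun t => qform M (u t)) =
  Er P (fun t => qform M (u t - Emx P u)) + qform M (Emx P u).
Proof.
move=> hu; set ub := Emx P u.
have two1 : (1 : R) <= 2 by rewrite ler1n.
have hv i : (fun t => (u t - ub) i 0) \in Lfun P 2%:E.
  by under eq_fun do rewrite !mxE; apply: LfunB => //; exact: Lfun_const.
have hv1 i : (fun t => (u t - ub) i 0) \in Lfun P 1%E by exact: Lfun2_Lfun1.
have Ev : Emx P (fun t => u t - ub) = 0.
  apply/matrixP => i j; rewrite ord1 !mxE.
  under eq_fun do rewrite !mxE.
  rewrite ErB; [|exact: Lfun2_Lfun1|exact: (@Lfun_const _ _ _ _ 1)].
  by rewrite Er_cst subrr.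
(* [M] may fail to be symmetric, so there are two cross terms; transposing one of them makes both a
   constant row times the deviation. *)
have dec t : qform M (u t) = qform M (u t - ub) + ((ub^T *m M^T) *m (u t - ub)) 0 0
    + ((ub^T *m M) *m (u t - ub)) 0 0 + qform M ub.
  have -> : ub^T *m M^T *m (u t - ub) = ((u t - ub)^T *m M *m ub)^T.
    by rewrite !trmx_mul trmxK mulmxA.
  by rewrite -[LHS](congr1 (qform M) (subrK ub (u t))) [LHS]qformD [((_)^T) 0 0]mxE.
under eq_fun do rewrite dec.
have hl := fun e => @Lfun_rowmul 1 (lexx _) e _ hv1.
have h1 := Lfun1_qform M hv.
have h2 := LfunD (lexx _) h1 (hl (ub^T *m M^T)).
have h3 := LfunD (lexx _) h2 (hl (ub^T *m M)).
rewrite (ErD h3); last exact: (@Lfun_const _ _ _ _ 1).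
by rewrite (ErD h2 (hl _)) (ErD h1 (hl _)) Er_cst !Er_rowmul// Ev !mulmx0 !mxE !addr0.
Qed.

End quadratic_expectation.

(** * One step of the dynamics *)

Section one_step.
Context (R : realType) (d : measure_display) (Omega : measurableType d)
        (P : probability Omega R).

Definition Ercov (X Y : Omega -> R) : R :=
  Er P (fun t => (X t - Er P X) * (Y t - Er P Y)).

Definition value (s t sxy txy sy ty : R) (X Y : Omega -> R) : R :=
  s * Ercov X X + 2 * sxy * Ercov X Y + sy * Ercov Y Y
  + t * Er P X ^+ 2 + 2 * txy * Er P X * Er P Y + ty * Er P Y ^+ 2.

Lemma Lfun2_center X : X \in Lfun P 2%:E -> (fun t => X t - Er P X) \in Lfun P 2%:E.
Proof. by move=> hX; apply: LfunB; rewrite ?ler1n//; exact: Lfun_const. Qed.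

Lemma Er_center X : X \in Lfun P 2%:E -> Er P (fun t => X t - Er P X) = 0.
Proof.
move=> hX; rewrite ErB ?Er_cst ?subrr//; first exact: Lfun2_Lfun1.
exact: (@Lfun_const _ _ _ _ 1).
Qed.

Lemma Er_mul (X Y : Omega -> R) : X \in Lfun P 2%:E -> Y \in Lfun P 2%:E ->
  Er P (fun t => X t * Y t) = Ercov X Y + Er P X * Er P Y.
Proof.
move=> hX hY; have hXY := Lfun1_mul hX hY.
have h1 := LfunZ (lexx _) (Er P Y) (Lfun2_Lfun1 hX).
have h2 := LfunZ (lexx _) (Er P X) (Lfun2_Lfun1 hY).
have h3 := @Lfun_const _ _ _ P 1 (Er P X * Er P Y).
have -> : Ercov X Y =
    Er P (fun t => X t * Y t - Er P Y * X t - Er P X * Y t + Er P X * Er P Y).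
  by congr (Er P _); apply/funext => t; ring.
rewrite (ErD (LfunB (lexx _) (LfunB (lexx _) hXY h1) h2) h3).
rewrite (ErB (LfunB (lexx _) hXY h1) h2) (ErB hXY h1) Er_cst !ErZ; do ?exact: Lfun2_Lfun1.
by ring.
Qed.

(** The feedback carries a minus sign, so subtracting it from the control gives the plus here. The
    gains [p] and [q] are later [a * s] and [f * sxy], the coefficients left by the linear terms of
    the value. *)
Definition centered_gap (m : nat) (W : 'M[R]_m) (e : 'rV[R]_m)
    (u : Omega -> 'cV[R]_m) (x y : Omega -> R) (p q : R) (o : Omega) : 'cV[R]_m :=
  u o - Emx P u + (p * (x o - Er P x) + q * (y o - Er P y)) *: (invmx W *m e^T).

Definition mean_gap (m : nat) (W : 'M[R]_m) (e : 'rV[R]_m)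
    (u : Omega -> 'cV[R]_m) (x y : Omega -> R) (p q : R) : 'cV[R]_m :=
  Emx P u + (p * Er P x + q * Er P y) *: (invmx W *m e^T).

Variable G : set (set Omega).
Hypothesis Gm : G `<=` measurable.
Variables (m : nat) (C : 'M[R]_m) (w : Omega -> 'cV[R]_m).
Hypothesis mean_w : forall i, is_cond_exp P G (fun t => w t i 0) (cst 0).
Hypothesis cov_w : forall i j,
  is_cond_exp P G (fun t => (w t *m (w t)^T) i j) (cst (C i j)).
Variables (e : 'rV[R]_m) (u : Omega -> 'cV[R]_m) (x y : Omega -> R) (a f : R).
Hypothesis mu : forall i, measurable_wrt G (fun t => u t i 0).
Hypothesis hu : forall i, (fun t => u t i 0) \in Lfun P 2%:E.
Hypothesis mx : measurable_wrt G x.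
Hypothesis hx : x \in Lfun P 2%:E.
Hypothesis my : measurable_wrt G y.
Hypothesis hy : y \in Lfun P 2%:E.

(** The excess return splits into its predictable part, with mean row [e], and the contribution [xi]
    of the noise. *)
Let xi t := ((w t)^T *m u t) 0 0.
Let x' t := a * x t + (e *m u t) 0 0 + xi t.
Let y' t := f * y t.
Let ub := Emx P u.
Let v t := u t - ub.
Let xc t := x t - Er P x.
Let yc t := y t - Er P y.
Let ev t := (e *m v t) 0 0.
(** The centered next asset without its noise: measurable for the past, hence orthogonal to [xi]. *)
Let h t := a * xc t + ev t.

Let two1 : (1 : R) <= 2. Proof. by rewrite ler1n. Qed.

Let hxi : xi \in Lfun P 2%:E. Proof. exact: Lfun2_noise mean_w cov_w _ mu hu. Qed.

Let hv i : (fun t => v t i 0) \in Lfun P 2%:E.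
Proof. by under eq_fun do rewrite !mxE; apply: LfunB => //; exact: Lfun_const. Qed.

Let hev : ev \in Lfun P 2%:E. Proof. exact: Lfun_rowmul. Qed.
Let hxc : xc \in Lfun P 2%:E. Proof. exact: Lfun2_center. Qed.
Let hyc : yc \in Lfun P 2%:E. Proof. exact: Lfun2_center. Qed.
Let hh : h \in Lfun P 2%:E.
Proof. by apply: LfunD => //; exact: LfunZ. Qed.

Let meu : measurable_wrt G (fun t => (e *m u t) 0 0).
Proof.
under eq_fun do rewrite mxE; apply: measurable_wrt_sum => i.
by apply: measurable_wrtM => //; exact: measurable_wrt_cst.
Qed.

Let mh : measurable_wrt G h.
Proof.
apply: measurable_wrtD.
  apply: measurable_wrtM; first exact: measurable_wrt_cst.
  by apply: measurable_wrtB => //; exact: measurable_wrt_cst.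
have -> : ev = (fun t => (e *m u t) 0 0 - (e *m ub) 0 0).
  by apply/funext => t; rewrite /ev rowmulB.
by apply: measurable_wrtB => //; exact: measurable_wrt_cst.
Qed.

Lemma Lfun2_step : x' \in Lfun P 2%:E.
Proof.
by apply: LfunD => //; apply: LfunD => //; [exact: LfunZ|exact: Lfun_rowmul].
Qed.

Lemma Er_step : Er P x' = a * Er P x + (e *m ub) 0 0.
Proof.
have hax : (fun t => a * x t) \in Lfun P 1%E by apply: Lfun2_Lfun1; exact: LfunZ.
have heu : (fun t => (e *m u t) 0 0) \in Lfun P 1%E.
  by apply: Lfun2_Lfun1; exact: Lfun_rowmul.
rewrite (ErD (LfunD (lexx _) hax heu) (Lfun2_Lfun1 hxi)) (ErD hax heu).
rewrite ErZ ?Er_rowmul; last exact: Lfun2_Lfun1; last by move=> i; exact: Lfun2_Lfun1.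
by rewrite (Er_noise Gm mean_w cov_w mu hu) addr0.
Qed.

Let x'E t : x' t - Er P x' = h t + xi t.
Proof. by rewrite Er_step /x' /h /xc /ev /v rowmulB; ring. Qed.

Let y'E t : y' t - Er P y' = f * yc t.
Proof. by rewrite ErZ ?mulrBr//; exact: Lfun2_Lfun1. Qed.

(** The noise multiplies the whole control and not only its centered part, so the last term involves
    [u] itself. The mean of the control thus contributes to the variance of the next asset, which is
    why [W2] contains the covariance weighted by [s] and not by [t]. *)
Lemma Ercov_step_xx : Ercov x' x' =
  a ^+ 2 * Ercov x x + 2 * a * Er P (fun t => xc t * ev t)
  + Er P (fun t => ev t ^+ 2) + Er P (fun t => qform C (u t)).
Proof.
have -> : Ercov x' x' = Er P (fun t => a ^+ 2 * (xc t * xc t)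
    + (2 * a) * (xc t * ev t) + ev t ^+ 2 + 2 * (h t * xi t) + xi t ^+ 2).
  by congr (Er P _); apply/funext => t; rewrite x'E /h; ring.
have h1 := LfunZ (lexx _) (a ^+ 2) (Lfun1_mul hxc hxc).
have h2 := LfunZ (lexx _) (2 * a) (Lfun1_mul hxc hev).
have h3 := Lfun1_sqr hev.
have h4 := LfunZ (lexx _) 2 (Lfun1_mul hh hxi).
have h5 := Lfun1_sqr hxi.
have h12 := LfunD (lexx _) h1 h2; have h123 := LfunD (lexx _) h12 h3.
rewrite (ErD (LfunD (lexx _) h123 h4) h5) (ErD h123 h4) (ErD h12 h3) (ErD h1 h2).
rewrite !ErZ; do ?exact: Lfun1_mul.
rewrite (Er_mul_noise Gm mean_w cov_w mu hu mh hh).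
by rewrite (Er_noise_sqr Gm mean_w cov_w mu hu) mulr0 addr0.
Qed.

(** The liability receives no noise, and its centered value belongs to the past, so its product with
    [xi] averages to zero. *)
Lemma Ercov_step_xy : Ercov x' y' =
  a * f * Ercov x y + f * Er P (fun t => yc t * ev t).
Proof.
have -> : Ercov x' y' = Er P (fun t =>
    (a * f) * (xc t * yc t) + f * (yc t * ev t) + f * (yc t * xi t)).
  by congr (Er P _); apply/funext => t; rewrite x'E y'E /h; ring.
have h1 := LfunZ (lexx _) (a * f) (Lfun1_mul hxc hyc).
have h2 := LfunZ (lexx _) f (Lfun1_mul hyc hev).
have h3 := LfunZ (lexx _) f (Lfun1_mul hyc hxi).
rewrite (ErD (LfunD (lexx _) h1 h2) h3) (ErD h1 h2) !ErZ; do ?exact: Lfun1_mul.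
rewrite (Er_mul_noise Gm mean_w cov_w mu hu)//.
  by rewrite mulr0 addr0.
by apply: measurable_wrtB => //; exact: measurable_wrt_cst.
Qed.

Lemma Ercov_step_yy : Ercov y' y' = f ^+ 2 * Ercov y y.
Proof.
rewrite -ErZ; last exact: Lfun1_mul.
by congr (Er P _); apply/funext => t; rewrite !y'E /yc; ring.
Qed.

Lemma Er_step_y : Er P y' = f * Er P y.
Proof. by rewrite ErZ//; exact: Lfun2_Lfun1. Qed.

Lemma Lfun2_centered_gap W p q i :
  (fun o => centered_gap W e u x y p q o i 0) \in Lfun P 2%:E.
Proof.
have -> : (fun o => centered_gap W e u x y p q o i 0) = (fun o => v o i 0
    + (invmx W *m e^T) i 0 * (p * xc o + q * yc o)).
  by apply/funext => o; rewrite [LHS]mxE [X in _ + X]mxE mulrC.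
apply: LfunD => //; apply: LfunZ => //; apply: LfunD => //; exact: LfunZ.
Qed.

Variables (Rk W1 W2 : 'M[R]_m) (s t sxy txy sy ty : R).
Hypothesis W1E : W1 = Rk + s *: (C + e^T *m e).
Hypothesis W2E : W2 = Rk + t *: (e^T *m e) + s *: C.
Hypotheses (W1sym : W1^T = W1) (W1unit : W1 \in unitmx).
Hypotheses (W2sym : W2^T = W2) (W2unit : W2 \in unitmx).
Let b1 := (e *m invmx W1 *m e^T) 0 0.
Let b2 := (e *m invmx W2 *m e^T) 0 0.
Let gap1 := centered_gap W1 e u x y (a * s) (f * sxy).
Let gap2 := mean_gap W2 e u x y (a * t) (f * txy).

(** The quadratic terms in the control assemble into [W1] for its centered part and into [W2] for
    its mean. Completing each square leaves minus the squared linear coefficient times [b1] or [b2];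
    these remainders are the subtracted terms of the recursions. *)
Lemma value_step :
  Er P (fun o => qform Rk (u o)) + value s t sxy txy sy ty x' y' =
  value (a ^+ 2 * s * (1 - s * b1)) (a ^+ 2 * t * (1 - t * b2))
        (a * f * sxy * (1 - s * b1)) (a * f * txy * (1 - t * b2))
        (f ^+ 2 * (sy - sxy ^+ 2 * b1)) (f ^+ 2 * (ty - txy ^+ 2 * b2)) x y
  + Er P (fun o => qform W1 (gap1 o)) + qform W2 gap2.
Proof.
rewrite /value Ercov_step_xx Ercov_step_xy Ercov_step_yy Er_step Er_step_y.
rewrite (Er_qform_center Rk hu) (Er_qform_center C hu) -/ub.
have -> : (fun o => qform W1 (gap1 o)) =
    (fun o => qform Rk (v o) + s * qform C (v o) + s * ev o ^+ 2
      + (2 * a * s) * (xc o * ev o) + (2 * f * sxy) * (yc o * ev o)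
      + ((a * s) ^+ 2 * b1) * (xc o * xc o) + (2 * a * f * s * sxy * b1) * (xc o * yc o)
      + ((f * sxy) ^+ 2 * b1) * (yc o * yc o)).
  apply/funext => o; rewrite /gap1 /centered_gap -/(v o) -/(xc o) -/(yc o).
  rewrite complete_square// -/b1 -/(ev o) W1E.
  by rewrite !(qformDm, qformZm) qform_outer -/(ev o); ring.
have k1 := Lfun1_qform Rk hv.
have k2 := LfunZ (lexx _) s (Lfun1_qform C hv).
have k3 := LfunZ (lexx _) s (Lfun1_sqr hev).
have k4 := LfunZ (lexx _) (2 * a * s) (Lfun1_mul hxc hev).
have k5 := LfunZ (lexx _) (2 * f * sxy) (Lfun1_mul hyc hev).
have k6 := LfunZ (lexx _) ((a * s) ^+ 2 * b1) (Lfun1_mul hxc hxc).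
have k7 := LfunZ (lexx _) (2 * a * f * s * sxy * b1) (Lfun1_mul hxc hyc).
have k8 := LfunZ (lexx _) ((f * sxy) ^+ 2 * b1) (Lfun1_mul hyc hyc).
have s2 := LfunD (lexx _) k1 k2; have s3 := LfunD (lexx _) s2 k3.
have s4 := LfunD (lexx _) s3 k4; have s5 := LfunD (lexx _) s4 k5.
have s6 := LfunD (lexx _) s5 k6; have s7 := LfunD (lexx _) s6 k7.
rewrite (ErD s7 k8) (ErD s6 k7) (ErD s5 k6) (ErD s4 k5) (ErD s3 k4).
rewrite (ErD s2 k3) (ErD k1 k2).
rewrite !ErZ; do ?[exact: Lfun1_mul|exact: Lfun1_qform|exact: Lfun1_sqr].
rewrite /gap2 /mean_gap -/ub complete_square// -/b2 W2E !(qformDm, qformZm) qform_outer.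
rewrite -!/(Ercov _ _) -/(Ercov x x) -/(Ercov x y) -/(Ercov y y).
by rewrite -/v; ring.
Qed.

End one_step.

(** * The asset-liability model *)

Section generated_information.
Context (R : realType) (d : measure_display) (Omega : measurableType d).
Implicit Types (X : Omega -> R) (G : set (set Omega)).

Lemma measurable_wrt_generators G X : generators X `<=` G -> measurable_wrt G X.
Proof. by move=> h _ A mA; apply: sub_sigma_algebra; apply: h; exists A. Qed.

Lemma generators_measurable X : measurable_fun setT X -> generators X `<=` measurable.
Proof. by move=> mX _ [A mA <-]; exact: mX. Qed.

Lemma measurable_wrt_sub G1 G2 X : G1 `<=` G2 ->
  measurable_wrt G1 X -> measurable_wrt G2 X.
Proof.
move=> G12 mX _ A mA; have := mX measurableT A mA.
apply: smallest_sub; first exact: smallest_sigma_algebra.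
by move=> S /G12; exact: sub_sigma_algebra.
Qed.

End generated_information.

Section asset_liability.
Context (R : realType) (d : measure_display) (Omega : measurableType d)
        (P : probability Omega R) (N m : nat) (a f : nat -> R)
        (B : nat -> Omega -> 'rV[R]_m).
Hypothesis hB2 : forall k, (k < N)%N ->
  forall j, (fun t => B k t 0 j) \in Lfun P 2%:E.
Variables (zx zy : Omega -> R).
Hypotheses (hzx : zx \in Lfun P 2%:E) (hzy : zy \in Lfun P 2%:E).
Hypothesis mean_noise : forall k, (k < N)%N -> forall i,
  is_cond_exp P (info P B zx zy k) (fun t => noise P B k t i 0) (cst 0).
Hypothesis cov_noise : forall k, (k < N)%N -> forall i j,
  is_cond_exp P (info P B zx zy k)
    (fun t => (noise P B k t *m (noise P B k t)^T) i j)
    (cst (Covmx P (B k) i j)).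

Local Notation info k := (info P B zx zy k).
Local Notation EB k := (Emx P (B k)).
Local Notation y k := (liability f zy k).
Local Notation x u k := (asset a B zx u k).

Let two1 : (1 : R) <= 2. Proof. by rewrite ler1n. Qed.

(** The bound includes [N]: [info k] involves only noises of index below [k], and the terminal asset
    is adapted to [info N]. *)
Lemma info_measurable k : (k <= N)%N -> info k `<=` measurable.
Proof.
move=> kN A [[|]|[l /= lk [j _]]].
- exact/generators_measurable/Lfun_measurable/hzx.
- exact/generators_measurable/Lfun_measurable/hzy.
- apply: generators_measurable.
  have -> : (fun t => (noise P B l t)^T 0 j) = (fun t => B l t 0 j - EB l 0 j).
    by apply/funext => t; rewrite !mxE.
  apply: (@Lfun_measurable _ _ _ P 2%:E).
  by apply: LfunB => //; [exact: hB2 (leq_trans lk kN) _|exact: Lfun_const].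
Qed.

Lemma info_sub k l : (k <= l)%N -> info k `<=` info l.
Proof.
move=> kl A [H|[i /= ik H]]; [by left|right; exists i => //=].
exact: leq_trans ik kl.
Qed.

Lemma measurable_wrt_noise k i : measurable_wrt (info k.+1) (fun t => noise P B k t i 0).
Proof.
apply: measurable_wrt_generators => A HA; right; exists k => //=.
exists i => //; move: HA; congr (generators _ A).
by apply/funext => t; rewrite [RHS]mxE.
Qed.

Lemma measurable_wrt_zx k : measurable_wrt (info k) zx.
Proof. by apply: measurable_wrt_generators => A HA; left; left. Qed.

Lemma measurable_wrt_liability k l : measurable_wrt (info k) (y l).
Proof.
elim: l => [|l ih] /=.
  by apply: measurable_wrt_generators => A HA; left; right.
by apply: measurable_wrtM => //; exact: measurable_wrt_cst.
Qed.

Lemma Lfun2_liability k : y k \in Lfun P 2%:E.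
Proof. by elim: k => [//|k ih] /=; exact: LfunZ. Qed.

Lemma Er_liability k : Er P (y k) = (\prod_(j < k) f j) * Er P zy.
Proof.
elim: k => [|k ih]; first by rewrite big_ord0 mul1r.
rewrite big_ord_recr /= ErZ ?ih; last exact/Lfun2_Lfun1/Lfun2_liability.
by ring.
Qed.

Lemma asset_step u k : x u k.+1 = (fun t => a k * x u k t
  + (EB k *m u k t) 0 0 + ((noise P B k t)^T *m u k t) 0 0).
Proof.
apply/funext => t /=; rewrite /noise trmxK -addrA; congr (_ + _).
by rewrite mulmxBl [X in _ = _ + X]mxE [X in _ = _ + (_ + X)]mxE; ring.
Qed.

(** Stated for a single stage, so that it can be assumed for past stages only while the optimal
    control is still being shown admissible. *)
Definition square_adapted (u : nat -> Omega -> 'cV[R]_m) (k : nat) : Prop :=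
  (forall i, measurable_wrt (info k) (fun t => u k t i 0)) /\
  (forall i, (fun t => u k t i 0) \in Lfun P 2%:E).

Lemma admissibleP u : admissible P N B zx zy u <->
  forall k, (k < N)%N -> square_adapted u k.
Proof.
split=> hu k kN; have [mu hk] := hu k kN; split => //.
- move=> i; apply: Lfun2_of_sqr.
    by apply: measurable_wrtW (mu i); exact/info_measurable/ltnW.
  apply: le_lt_trans hk; apply: expectation_le.
  + apply: measurable_funX; apply: measurable_wrtW (mu i).
    exact/info_measurable/ltnW.
  + apply: (@measurable_wrtW _ _ _ (info k)); first exact/info_measurable/ltnW.
    apply: measurable_wrt_sum => j; under eq_fun do rewrite expr2.
    exact: measurable_wrtM.
  + by move=> t; exact: sqr_ge0.
  + by move=> t; apply: sumr_ge0 => j _; exact: sqr_ge0.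
  + apply/aeW => t; rewrite (bigD1 i)//= lerDl.
    by apply: sumr_ge0 => j _; exact: sqr_ge0.
- rewrite ErE ?ltry//; apply: (@Lfun_sum _ _ _ _ 1) => // i.
  exact: Lfun1_sqr.
Qed.

Lemma asset_adapted u k : (k <= N)%N -> (forall l, (l < k)%N -> square_adapted u l) ->
  measurable_wrt (info k) (x u k) /\ x u k \in Lfun P 2%:E.
Proof.
elim: k => [|k ih] kN hu; first by split=> //; exact: measurable_wrt_zx.
have [|mx hx] := ih (ltnW kN); first by move=> l lk; apply: hu; exact: ltnW.
have [mu hk] := hu k (ltnSn k).
have up Z : measurable_wrt (info k) Z -> measurable_wrt (info k.+1) Z.
  by apply: measurable_wrt_sub; exact: info_sub.
rewrite asset_step; split.
  apply: measurable_wrtD; [apply: measurable_wrtD|].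
  - by apply: measurable_wrtM; [exact: measurable_wrt_cst|exact: up].
  - under eq_fun do rewrite mxE; apply: measurable_wrt_sum => i.
    by apply: measurable_wrtM; [exact: measurable_wrt_cst|exact: up].
  - under eq_fun do rewrite mxE; apply: measurable_wrt_sum => i.
    under eq_fun do rewrite [(noise P B k _)^T 0 i]mxE.
    by apply: measurable_wrtM; [exact: measurable_wrt_noise|exact: up].
exact: (Lfun2_step (info_measurable (ltnW kN)) (mean_noise kN) (cov_noise kN)
  (EB k) (a k) mu hk hx).
Qed.

(** Taking the constant [v] as control in [Er_noise_sqr] exhibits the form as the mean of a
    square. *)
Lemma Covmx_ge0 k v : (k < N)%N -> 0 <= qform (Covmx P (B k)) v.
Proof.
move=> kN; rewrite -(Er_cst P (qform _ v)).
rewrite -(@Er_noise_sqr _ _ _ _ _ (info_measurable (ltnW kN)) _ _ _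
  (mean_noise kN) (cov_noise kN) (fun=> v)).
- by apply: Er_ge0 => t; exact: sqr_ge0.
- by move=> i; exact: measurable_wrt_cst.
- by move=> i; exact: Lfun_const.
Qed.

(** * Riccati recursions and definiteness *)

Variables (Rw : nat -> 'M[R]_m) (qN qbarN : R).
Hypothesis hRsym : forall k, (k < N)%N -> (Rw k)^T = Rw k.
Hypothesis hRpos : forall k, (k < N)%N -> posdefmx (Rw k).
Hypotheses (hq : 0 <= qN) (hqbar : 0 <= qN + qbarN).
Variables (Sx Tx Sxy Txy Sy Ty : nat -> R).
Let W1 k := Rw k + Sx k.+1 *: Emx P (fun t => (B k t)^T *m B k t).
Let W2 k := Rw k + Tx k.+1 *: ((EB k)^T *m EB k) + Sx k.+1 *: Covmx P (B k).
Let b1 k := (EB k *m invmx (W1 k) *m (EB k)^T) 0 0.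
Let b2 k := (EB k *m invmx (W2 k) *m (EB k)^T) 0 0.
Hypotheses (SxN : Sx N = qN) (TxN : Tx N = qN + qbarN)
  (SxyN : Sxy N = - qN) (TxyN : Txy N = - qN - qbarN)
  (SyN : Sy N = qN) (TyN : Ty N = qN + qbarN).
Hypothesis Sx_rec : forall k, (k < N)%N ->
  Sx k = a k ^+ 2 * Sx k.+1 * (1 - Sx k.+1 * b1 k).
Hypothesis Tx_rec : forall k, (k < N)%N ->
  Tx k = a k ^+ 2 * Tx k.+1 * (1 - Tx k.+1 * b2 k).
Hypothesis Sxy_rec : forall k, (k < N)%N ->
  Sxy k = a k * f k * Sxy k.+1 * (1 - Sx k.+1 * b1 k).
Hypothesis Txy_rec : forall k, (k < N)%N ->
  Txy k = a k * f k * Txy k.+1 * (1 - Tx k.+1 * b2 k).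
Hypothesis Sy_rec : forall k, (k < N)%N ->
  Sy k = f k ^+ 2 * (Sy k.+1 - Sxy k.+1 ^+ 2 * b1 k).
Hypothesis Ty_rec : forall k, (k < N)%N ->
  Ty k = f k ^+ 2 * (Ty k.+1 - Txy k.+1 ^+ 2 * b2 k).

Let W1E k : W1 k = Rw k + Sx k.+1 *: (Covmx P (B k) + (EB k)^T *m EB k).
Proof. by rewrite /Covmx subrK. Qed.

Let outer_sym k : ((EB k)^T *m EB k)^T = (EB k)^T *m EB k.
Proof. by rewrite trmx_mul trmxK. Qed.

Let W1sym k : (k < N)%N -> (W1 k)^T = W1 k.
Proof.
move=> kN; rewrite W1E [LHS]raddfD /= hRsym// linearZ /= [(_ + _)^T]raddfD /=.
by rewrite trmx_Covmx outer_sym.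
Qed.

Let W2sym k : (k < N)%N -> (W2 k)^T = W2 k.
Proof.
move=> kN; rewrite /W2 [LHS]raddfD /= [(_ + _)^T]raddfD /= hRsym// !linearZ /=.
by rewrite trmx_Covmx outer_sym.
Qed.

Let W1pos k : (k < N)%N -> 0 <= Sx k.+1 -> posdefmx (W1 k).
Proof.
move=> kN S0; rewrite W1E; apply: posdefmxD; first exact: hRpos.
move=> v; rewrite qformZm qformDm qform_outer.
by rewrite mulr_ge0// addr_ge0 ?sqr_ge0// Covmx_ge0.
Qed.

Let W2pos k : (k < N)%N -> 0 <= Sx k.+1 -> 0 <= Tx k.+1 -> posdefmx (W2 k).
Proof.
move=> kN S0 T0; rewrite /W2; apply: posdefmxD.
  apply: posdefmxD; first exact: hRpos.
  by move=> v; rewrite qformZm qform_outer mulr_ge0// sqr_ge0.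
by move=> v; rewrite qformZm mulr_ge0// Covmx_ge0.
Qed.

(** The two signs go together because [W2] contains [Sx] as well as [Tx]. The Riccati factors are
    nonnegative since [W1] dominates [Sx k.+1] times the outer product of the mean, and [W2]
    dominates [Tx k.+1] times it. *)
Lemma riccati_ge0 k : (k <= N)%N -> 0 <= Sx k /\ 0 <= Tx k.
Proof.
(* Backward induction from [N], run as an ordinary induction on the number of remaining periods. *)
move=> kN; rewrite -(subKn kN); elim: (N - k)%N (leq_subr k N) => [_|n ih nN].
  by rewrite subn0 SxN TxN.
have [S0 T0] := ih (ltnW nN); set l := (N - n.+1)%N.
have lN : (l < N)%N by rewrite /l ltn_subrL (leq_ltn_trans _ nN).
have lS : (N - n)%N = l.+1 by rewrite /l subnSK.
rewrite lS in S0 T0; rewrite Sx_rec// Tx_rec//; split.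
  apply: mulr_ge0; first by rewrite mulr_ge0 ?sqr_ge0.
  apply: riccati_factor_ge0; [exact: W1sym|exact: W1pos|move=> v].
  rewrite W1E qformDm qformZm qformDm qform_outer mulrDr addrA lerDr.
  by rewrite addr_ge0 ?posdefmx_ge0 ?mulr_ge0 ?Covmx_ge0//; exact: hRpos.
apply: mulr_ge0; first by rewrite mulr_ge0 ?sqr_ge0.
apply: riccati_factor_ge0; [exact: W2sym|exact: W2pos|move=> v].
rewrite /W2 !qformDm !qformZm qform_outer addrAC lerDr.
by rewrite addr_ge0 ?posdefmx_ge0 ?mulr_ge0 ?Covmx_ge0//; exact: hRpos.
Qed.

Let W1pd k : (k < N)%N -> posdefmx (W1 k).
Proof. by move=> kN; have [S0 _] := riccati_ge0 kN; exact: W1pos. Qed.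

Let W2pd k : (k < N)%N -> posdefmx (W2 k).
Proof. by move=> kN; have [S0 T0] := riccati_ge0 kN; exact: W2pos. Qed.

(** * Telescoping the cost *)

Definition value_at (u : nat -> Omega -> 'cV[R]_m) (k : nat) : R :=
  value P (Sx k) (Tx k) (Sxy k) (Txy k) (Sy k) (Ty k) (x u k) (y k).

Let gap1 (u : nat -> Omega -> 'cV[R]_m) (k : nat) :=
  centered_gap P (W1 k) (EB k) (u k) (x u k) (y k) (a k * Sx k.+1) (f k * Sxy k.+1).

Let gap2 (u : nat -> Omega -> 'cV[R]_m) (k : nat) :=
  mean_gap P (W2 k) (EB k) (u k) (x u k) (y k) (a k * Tx k.+1) (f k * Txy k.+1).

Definition loss (u : nat -> Omega -> 'cV[R]_m) (k : nat) : R :=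
  Er P (fun t => qform (W1 k) (gap1 u k t)) + qform (W2 k) (gap2 u k).

Lemma value_telescope u n : (n <= N)%N -> (forall l, (l < n)%N -> square_adapted u l) ->
  \sum_(k < n) Er P (fun t => qform (Rw k) (u k t)) + value_at u n
  = value_at u 0 + \sum_(k < n) loss u k.
Proof.
elim: n => [|n ih] nN hu; first by rewrite !big_ord0 add0r addr0.
have hu' l : (l < n)%N -> square_adapted u l by move=> ln; exact/hu/ltnW.
have [mx hx] := asset_adapted (ltnW nN) hu'.
have [mu hun] := hu n (ltnSn n).
have my : measurable_wrt (info n) (y n) by exact: measurable_wrt_liability.
have step := value_step (info_measurable (ltnW nN)) (mean_noise nN) (cov_noise nN)
  (a n) (f n) mu hun mx hx my (Lfun2_liability n)
  (Sxy n.+1) (Txy n.+1) (Sy n.+1) (Ty n.+1) (W1E n) (erefl (W2 n))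
  (W1sym nN) (posdefmx_unitmx (W1pd nN)) (W2sym nN) (posdefmx_unitmx (W2pd nN)).
have {step} : Er P (fun t => qform (Rw n) (u n t)) + value_at u n.+1
    = value_at u n + loss u n.
  rewrite /value_at asset_step; apply: (etrans step); rewrite -[LHS]addrA.
  by rewrite -Sx_rec// -Tx_rec// -Sxy_rec// -Txy_rec// -Sy_rec// -Ty_rec.
rewrite !big_ord_recr /= => step.
by rewrite -addrA step addrA ih ?(ltnW nN)//; ring.
Qed.

(** Splitting the second moment of the terminal surplus into variance plus squared mean puts the
    weight [qN] on the variance and [qN + qbarN] on the squared mean. Expanding both gives the
    terminal values of the six coefficients. *)
Lemma costE u : (forall k, (k < N)%N -> square_adapted u k) ->
  cost P N a f B Rw qN qbarN zx zy u =
  (value_at u 0 + \sum_(k < N) loss u k)%:E.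
Proof.
move=> hu; rewrite -value_telescope//.
have [_ hx] := asset_adapted (leqnn N) hu; have hy := Lfun2_liability N.
have hx1 := Lfun2_Lfun1 hx; have hy1 := Lfun2_Lfun1 hy.
have hz := LfunB two1 hx hy.
rewrite /cost ErE; last by apply: (@LfunZ _ _ _ _ 1) => //; exact: Lfun1_sqr.
rewrite ErE; last exact: Lfun2_Lfun1.
have -> : (\sum_(k < N) 'E_P[fun t => (((u k t)^T *m Rw k *m u k t) 0 0)%R] =
    (\sum_(k < N) Er P (fun t => qform (Rw k) (u k t)))%:E)%E.
  rewrite -sumEFin; apply: eq_bigr => k _; rewrite ErE//.
  by apply: Lfun1_qform; have [] := hu k (ltn_ord k).
rewrite -EFin_expe -EFinM -!EFinD; congr (_%:E).
rewrite ErZ; last exact: Lfun1_sqr.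
rewrite ErB// -addrA; congr (_ + _).
have -> : (fun t => (x u N t - y N t) ^+ 2) = (fun t => x u N t * x u N t
    - 2 * (x u N t * y N t) + y N t * y N t) by apply/funext => t; ring.
have hxy := LfunZ (lexx _) 2 (Lfun1_mul hx hy).
rewrite (ErD (LfunB (lexx _) (Lfun1_mul hx hx) hxy) (Lfun1_mul hy hy)).
rewrite (ErB (Lfun1_mul hx hx) hxy) ErZ; last exact: Lfun1_mul.
rewrite !Er_mul// /value_at /value SxN TxN SxyN TxyN SyN TyN.
by ring.
Qed.

Lemma loss_ge0 u k : (k < N)%N -> 0 <= loss u k.
Proof.
move=> kN; apply: addr_ge0; last exact: posdefmx_ge0 (W2pd kN).
by apply: Er_ge0 => t; exact: posdefmx_ge0 (W1pd kN).
Qed.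

(** * The feedback law and the loss *)

Definition feedback (k : nat) (X : Omega -> R) (t : Omega) : 'cV[R]_m :=
  - ((X t - Er P X) *: (invmx (W1 k) *m ((a k * Sx k.+1) *: EB k)^T))
  - Er P X *: (invmx (W2 k) *m ((a k * Tx k.+1) *: EB k)^T)
  - (y k t - Er P (y k)) *: (invmx (W1 k) *m ((f k * Sxy k.+1) *: EB k)^T)
  - Er P (y k) *: (invmx (W2 k) *m ((f k * Txy k.+1) *: EB k)^T).

(** Four gains collapse onto two directions, one for each weight matrix, which is the shape of the
    two gaps. *)
Lemma feedbackE k X t : feedback k X t =
  - (a k * Sx k.+1 * (X t - Er P X) + f k * Sxy k.+1 * (y k t - Er P (y k)))
      *: (invmx (W1 k) *m (EB k)^T)
  - (a k * Tx k.+1 * Er P X + f k * Txy k.+1 * Er P (y k))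
      *: (invmx (W2 k) *m (EB k)^T).
Proof.
have tZ (c : R) (v : 'rV[R]_m) : (c *: v)^T = c *: v^T by exact: linearZ.
rewrite /feedback !tZ -!scalemxAr !scalerA.
set z1 := invmx (W1 k) *m _; set z2 := invmx (W2 k) *m _.
apply/matrixP => i j; rewrite !mxE.
by ring.
Qed.

Lemma Lfun2_feedback k X i : X \in Lfun P 2%:E ->
  (fun t => feedback k X t i 0) \in Lfun P 2%:E.
Proof.
move=> hX; under eq_fun do rewrite feedbackE !mxE mulrC.
apply: LfunB => //; last exact: Lfun_const.
apply: LfunZ => //; apply: LfunN => //.
apply: LfunD => //; apply: LfunZ => //; apply: Lfun2_center => //.
exact: Lfun2_liability.
Qed.

Lemma measurable_wrt_feedback k X i : measurable_wrt (info k) X ->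
  measurable_wrt (info k) (fun t => feedback k X t i 0).
Proof.
have mc c : measurable_wrt (info k) (fun=> c) by exact: measurable_wrt_cst.
move=> mX; under eq_fun do rewrite feedbackE !mxE.
apply: measurable_wrtB => //; apply: measurable_wrtM => //; apply: measurable_wrtN.
apply: measurable_wrtD; apply: measurable_wrtM => //; apply: measurable_wrtB => //.
exact: measurable_wrt_liability.
Qed.

Lemma Emx_feedback k X : X \in Lfun P 2%:E ->
  Emx P (feedback k X) =
  - (a k * Tx k.+1 * Er P X + f k * Txy k.+1 * Er P (y k))
      *: (invmx (W2 k) *m (EB k)^T).
Proof.
move=> hX; have hy := Lfun2_liability k; apply/matrixP => i j; rewrite ord1 mxE.
set r := RHS.
have hXc := LfunZ two1 (a k * Sx k.+1) (Lfun2_center hX).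
have hyc := LfunZ two1 (f k * Sxy k.+1) (Lfun2_center hy).
have hs := LfunN two1 (@LfunD _ _ _ _ 2%:E two1 _ _ hXc hyc).
have -> : (fun t => feedback k X t i 0) = (fun t =>
    (invmx (W1 k) *m (EB k)^T) i 0 *
    - (a k * Sx k.+1 * (X t - Er P X) + f k * Sxy k.+1 * (y k t - Er P (y k))) + r).
  apply/funext => t; rewrite feedbackE [LHS]mxE; congr (_ + _).
    by rewrite mxE mulrC.
  by rewrite /r scaleNr.
rewrite (ErD (Lfun2_Lfun1 (LfunZ two1 _ hs)) (@Lfun_const _ _ _ _ 1 _)) Er_cst.
rewrite (ErZ _ (Lfun2_Lfun1 hs)) ErN; last exact/Lfun2_Lfun1/(LfunD (p := 2%:E)).
rewrite (ErD (Lfun2_Lfun1 hXc) (Lfun2_Lfun1 hyc)) !ErZ;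
  do ?exact/Lfun2_Lfun1/Lfun2_center.
by rewrite !Er_center// !mulr0 addr0 oppr0 mulr0 add0r.
Qed.

Lemma loss_feedback u k : x u k \in Lfun P 2%:E ->
  (forall t, u k t = feedback k (x u k) t) -> loss u k = 0.
Proof.
move=> hx uE; have Eu : Emx P (u k) = Emx P (feedback k (x u k)).
  by congr (Emx P _); apply/funext.
rewrite /loss /gap2 /mean_gap Eu Emx_feedback// -scalerDl addNr scale0r.
rewrite {2}/qform mulmx0 mxE addr0 -[RHS](Er_cst P); congr (Er P _); apply/funext => t.
rewrite /gap1 /centered_gap Eu uE Emx_feedback// feedbackE.
by rewrite !scaleNr opprK subrK addNr /qform mulmx0 mxE.
Qed.

(** Both summands of the loss are nonnegative, so both vanish. Definiteness of [W2] then fixes the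
    mean of the control, and definiteness of [W1] its centered part almost surely. *)
Lemma feedback_of_loss u k : (k < N)%N -> square_adapted u k -> x u k \in Lfun P 2%:E ->
  loss u k = 0 -> {ae P, forall t, u k t = feedback k (x u k) t}.
Proof.
move=> kN [_ hu] hx /eqP.
have [q1 q2] := (W1pd kN, W2pd kN).
rewrite paddr_eq0; last 2 first.
- by apply: Er_ge0 => t; exact: posdefmx_ge0.
- exact: posdefmx_ge0.
move=> /andP[/eqP h1 /eqP /(posdefmx_qform0 q2) h2].
have := Er_ge0_eq0 (Lfun1_qform (W1 k) (Lfun2_centered_gap (EB k) hu hx
  (Lfun2_liability k) (W1 k) (a k * Sx k.+1) (f k * Sxy k.+1)))
  (fun t => posdefmx_ge0 _ q1) h1.
apply: filterS => t /(posdefmx_qform0 q1) /eqP; rewrite /centered_gap addr_eq0 => /eqP h3.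
rewrite feedbackE -(subrK (Emx P (u k)) (u k t)) h3 scaleNr; congr (_ + _).
by apply/eqP; rewrite -addr_eq0; apply/eqP.
Qed.

(** The feedback needs the asset, which itself depends on earlier controls. Since [feedback] takes
    the state as an argument, the closed loop can be solved first, by this recursion; the control is
    read off afterwards. *)
Fixpoint optimal_asset (k : nat) (t : Omega) : R :=
  if k is l.+1 then
    a l * optimal_asset l t + (B l t *m feedback l (optimal_asset l) t) 0 0
  else zx t.

Definition optimal_control (k : nat) : Omega -> 'cV[R]_m :=
  feedback k (optimal_asset k).

Lemma asset_optimal k : x optimal_control k = optimal_asset k.
Proof. by elim: k => //= k ih; apply/funext => t; rewrite ih. Qed.

Lemma optimal_controlE k t :
  optimal_control k t = feedback k (x optimal_control k) t.
Proof. by rewrite asset_optimal. Qed.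

Lemma optimal_adapted k : (k < N)%N -> square_adapted optimal_control k.
Proof.
elim/ltn_ind: k => k ih kN.
have [|mx hx] := asset_adapted (u := optimal_control) (ltnW kN).
  by move=> l lk; apply: ih => //; exact: ltn_trans kN.
rewrite asset_optimal in mx hx; split=> i.
  exact: measurable_wrt_feedback.
exact: Lfun2_feedback.
Qed.

Lemma Lfun2_optimal_asset k : (k <= N)%N -> x optimal_control k \in Lfun P 2%:E.
Proof.
move=> kN; have [|//] := asset_adapted (u := optimal_control) kN.
by move=> l lk; apply: optimal_adapted; exact: leq_trans kN.
Qed.

Lemma cost_optimal :
  cost P N a f B Rw qN qbarN zx zy optimal_control = (value_at optimal_control 0)%:E.
Proof.
rewrite costE; last exact: optimal_adapted.
rewrite big1 ?addr0// => k _; apply: loss_feedback.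
  exact/Lfun2_optimal_asset/ltnW.
exact: optimal_controlE.
Qed.

Lemma optimal_minimizer : is_minimizer P N a f B Rw qN qbarN zx zy optimal_control.
Proof.
split=> [|v /admissibleP hv]; first by apply/admissibleP; exact: optimal_adapted.
rewrite cost_optimal costE// lee_fin lerDl.
by apply: sumr_ge0 => k _; exact: loss_ge0.
Qed.

(** All losses of a minimizer vanish, so it follows the feedback of its own states. Almost sure
    equality of states and of controls then alternate forward in time, starting from the common
    initial value. *)
Lemma minimizer_unique u : is_minimizer P N a f B Rw qN qbarN zx zy u ->
  forall k, (k < N)%N -> {ae P, forall t, u k t = optimal_control k t}.
Proof.
case=> /admissibleP hu /(_ _ optimal_minimizer.1).
rewrite cost_optimal costE// lee_fin gerDl => loss_le0.
have loss0 k : (k < N)%N -> loss u k = 0.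
  move=> kN; apply/eqP; have /eqP := @le_anti _ _ _ 0 (introT andP (conj loss_le0
    (sumr_ge0 _ (fun (i : 'I_N) _ => loss_ge0 u (ltn_ord i))))).
  rewrite psumr_eq0 => [/allP/(_ (Ordinal kN))|i _]; last exact: loss_ge0.
  by rewrite mem_index_enum; apply.
have hxu k : (k <= N)%N -> x u k \in Lfun P 2%:E.
  move=> kN; have [|//] := asset_adapted kN (u := u).
  by move=> l lk; apply: hu; exact: leq_trans kN.
have control_eq k : (k < N)%N ->
    {ae P, forall t, x u k t = x optimal_control k t} ->
    {ae P, forall t, u k t = optimal_control k t}.
  move=> kN hx.
  have hux := hxu k (ltnW kN); have hox := Lfun2_optimal_asset (ltnW kN).
  (* The feedback also depends on the mean of the state, so pointwise agreement at [t] alone would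
     not suffice. *)
  have EE := Er_ae_eq (Lfun_measurable hux) (Lfun_measurable hox) hx.
  have := feedback_of_loss kN (hu k kN) hux (loss0 k kN).
  apply: filterS2 hx => t xt ->.
  by rewrite optimal_controlE !feedbackE xt EE.
have state_eq k : (k <= N)%N -> {ae P, forall t, x u k t = x optimal_control k t}.
  elim: k => [|k ih] kN; first exact: aeW.
  have hx := ih (ltnW kN).
  by apply: filterS2 hx (control_eq k kN hx) => t /= -> ->.
by move=> k kN; apply: control_eq => //; apply: state_eq; exact: ltnW.
Qed.

(** * Optimal value and mean terminal surplus *)

Lemma value_at0 u : (value_at u 0)%:E =
  'E_P[fun t => (Sx 0%N * (zx t - Er P zx) ^+ 2
     + Tx 0%N * Er P zx ^+ 2
     + 2 * Sxy 0%N * (zx t - Er P zx) * (zy t - Er P zy)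
     + 2 * Txy 0%N * Er P zx * Er P zy
     + Sy 0%N * (zy t - Er P zy) ^+ 2
     + Ty 0%N * Er P zy ^+ 2)%R]%E.
Proof.
have hxc := Lfun2_center hzx; have hyc := Lfun2_center hzy.
have k1 := LfunZ (lexx _) (Sx 0%N) (Lfun1_mul hxc hxc).
have k2 := LfunZ (lexx _) (2 * Sxy 0%N) (Lfun1_mul hxc hyc).
have k3 := LfunZ (lexx _) (Sy 0%N) (Lfun1_mul hyc hyc).
have k12 := LfunD (lexx _) k1 k2; have k123 := LfunD (lexx _) k12 k3.
pose c := Tx 0%N * Er P zx ^+ 2 + 2 * Txy 0%N * Er P zx * Er P zy + Ty 0%N * Er P zy ^+ 2.
have kc := @Lfun_const _ _ _ P 1 c.
rewrite [X in 'E_P[X]%E](_ : _ = (fun t =>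
    Sx 0%N * ((zx t - Er P zx) * (zx t - Er P zx))
    + 2 * Sxy 0%N * ((zx t - Er P zx) * (zy t - Er P zy))
    + Sy 0%N * ((zy t - Er P zy) * (zy t - Er P zy)) + c)); last first.
  by apply/funext => t; rewrite /c; ring.
rewrite ErE; last exact: LfunD.
rewrite (ErD k123 kc) (ErD k12 k3) (ErD k1 k2) Er_cst !ErZ; do ?exact: Lfun1_mul.
by congr (_%:E); rewrite /value_at /value /c /Ercov /=; ring.
Qed.

Let Nc k := a k * (1 - Tx k.+1 * b2 k).
Let Mc k := - (f k * Txy k.+1 * b2 k).

(** The [W1] part of the feedback has mean zero, so only [b2] enters the mean dynamics. *)
Lemma Er_optimal_step k : (k < N)%N -> Er P (x optimal_control k.+1) =
  Nc k * Er P (x optimal_control k) + Mc k * Er P (y k).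
Proof.
move=> kN; have hx := Lfun2_optimal_asset (ltnW kN).
have [mu hu] := optimal_adapted kN.
rewrite asset_step.
rewrite [LHS](Er_step (info_measurable (ltnW kN)) (mean_noise kN) (cov_noise kN)
  (EB k) (a k) mu hu hx).
have -> : Emx P (optimal_control k) = Emx P (feedback k (x optimal_control k)).
  by rewrite asset_optimal.
by rewrite Emx_feedback// -scalemxAr mulmxA mxE -/(b2 k) /Nc /Mc; ring.
Qed.

(** Variation of constants for a scalar linear recursion driven by the mean liability. *)
Lemma Er_optimal n : (n <= N)%N -> Er P (x optimal_control n) =
  (\prod_(k < n) Nc k) * Er P zx
  + (\sum_(k < n) (\prod_(k.+1 <= j < n) Nc j) * Mc k * (\prod_(j < k) f j)) * Er P zy.
Proof.
elim: n => [|n ih] nN; first by rewrite !big_ord0 mul1r mul0r addr0.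
rewrite Er_optimal_step// ih ?(ltnW nN)// Er_liability !big_ord_recr /=.
(* The newest summand has no later factor: its product over [Nc] is empty. *)
rewrite big_geq// mul1r.
have -> : \sum_(k < n) (\prod_(k.+1 <= j < n.+1) Nc j) * Mc k * (\prod_(j < k) f j)
    = Nc n * \sum_(k < n) (\prod_(k.+1 <= j < n) Nc j) * Mc k * (\prod_(j < k) f j).
  by rewrite mulr_sumr; apply: eq_bigr => k _; rewrite big_nat_recr//=; ring.
by ring.
Qed.

Lemma Er_optimal_surplus :
  'E_P[fun t => (x optimal_control N t - y N t)%R]%E =
  ((\prod_(k < N) Nc k) * Er P zx
   + (\sum_(k < N) (\prod_(k.+1 <= j < N) Nc j) * Mc k * (\prod_(j < k) f j)
      - \prod_(k < N) f k) * Er P zy)%:E.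
Proof.
have hx := Lfun2_optimal_asset (leqnn N); have hy := Lfun2_liability N.
rewrite ErE; last by apply: Lfun2_Lfun1; exact: LfunB.
rewrite ErB; do ?exact: Lfun2_Lfun1.
by congr (_%:E); rewrite Er_optimal// Er_liability; ring.
Qed.

End asset_liability.

Theorem theorem5p1 (R : realType) (d : measure_display)
    (Omega : measurableType d) (P : probability Omega R)
    (N m : nat) (hN : (0 < N)%N)
    (a f : nat -> R)
    (B : nat -> Omega -> 'rV[R]_m)
    (hB2 : forall k, (k < N)%N ->
       forall j, (fun t => B k t 0 j) \in Lfun P 2%:E)
    (hBind : independent_rows P N B)
    (Rw : nat -> 'M[R]_m) (qN qbarN : R)
    (hRsym : forall k, (k < N)%N -> (Rw k)^T = Rw k)
    (hRpos : forall k, (k < N)%N -> posdefmx (Rw k))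
    (hq : 0 <= qN) (hqbar : 0 <= qN + qbarN)
    (Sx Tx Sxy Txy Sy Ty : nat -> R) :
  let EB k := Emx P (B k) in
  let W1 k := Rw k + Sx k.+1 *: Emx P (fun t => (B k t)^T *m B k t) in
  let W2 k := Rw k + Tx k.+1 *: ((EB k)^T *m EB k)
              + Sx k.+1 *: Covmx P (B k) in
  let H1 k := (a k * Sx k.+1) *: EB k in
  let H2 k := (a k * Tx k.+1) *: EB k in
  let H3 k := (f k * Sxy k.+1) *: EB k in
  let H4 k := (f k * Txy k.+1) *: EB k in
  let b1 k := (EB k *m invmx (W1 k) *m (EB k)^T) 0 0 in
  let b2 k := (EB k *m invmx (W2 k) *m (EB k)^T) 0 0 in
  Sx N = qN -> Tx N = qN + qbarN ->
  Sxy N = - qN -> Txy N = - qN - qbarN ->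
  Sy N = qN -> Ty N = qN + qbarN ->
  (forall k, (k < N)%N -> Sx k = a k ^+ 2 * Sx k.+1 * (1 - Sx k.+1 * b1 k)) ->
  (forall k, (k < N)%N -> Tx k = a k ^+ 2 * Tx k.+1 * (1 - Tx k.+1 * b2 k)) ->
  (forall k, (k < N)%N ->
     Sxy k = a k * f k * Sxy k.+1 * (1 - Sx k.+1 * b1 k)) ->
  (forall k, (k < N)%N ->
     Txy k = a k * f k * Txy k.+1 * (1 - Tx k.+1 * b2 k)) ->
  (forall k, (k < N)%N ->
     Sy k = f k ^+ 2 * (Sy k.+1 - Sxy k.+1 ^+ 2 * b1 k)) ->
  (forall k, (k < N)%N ->
     Ty k = f k ^+ 2 * (Ty k.+1 - Txy k.+1 ^+ 2 * b2 k)) ->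
  forall zx zy : Omega -> R,
  zx \in Lfun P 2%:E -> zy \in Lfun P 2%:E ->
  (forall k, (k < N)%N -> forall i,
     is_cond_exp P (info P B zx zy k) (fun t => noise P B k t i 0) (cst 0)) ->
  (forall k, (k < N)%N -> forall i j,
     is_cond_exp P (info P B zx zy k)
       (fun t => (noise P B k t *m (noise P B k t)^T) i j)
       (cst (Covmx P (B k) i j))) ->
  exists uo : nat -> Omega -> 'cV[R]_m,
    let x := asset a B zx uo in
    let y := liability f zy in
    let Nc k := a k * (1 - Tx k.+1 * b2 k) in
    let Mc k := - (f k * Txy k.+1 * b2 k) in
    [/\ forall k, (k < N)%N -> forall t,
          uo k t =
            - ((x k t - Er P (x k)) *: (invmx (W1 k) *m (H1 k)^T))
            - Er P (x k) *: (invmx (W2 k) *m (H2 k)^T)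
            - (y k t - Er P (y k)) *: (invmx (W1 k) *m (H3 k)^T)
            - Er P (y k) *: (invmx (W2 k) *m (H4 k)^T),
        is_minimizer P N a f B Rw qN qbarN zx zy uo,
        forall u, is_minimizer P N a f B Rw qN qbarN zx zy u ->
          forall k, (k < N)%N -> {ae P, forall t, u k t = uo k t},
        cost P N a f B Rw qN qbarN zx zy uo =
          ('E_P[fun t => (Sx 0%N * (zx t - Er P zx) ^+ 2
                 + Tx 0%N * Er P zx ^+ 2
                 + 2 * Sxy 0%N * (zx t - Er P zx) * (zy t - Er P zy)
                 + 2 * Txy 0%N * Er P zx * Er P zy
                 + Sy 0%N * (zy t - Er P zy) ^+ 2
                 + Ty 0%N * Er P zy ^+ 2)%R])%E &
        ('E_P[fun t => (x N t - y N t)%R])%E =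
          ((\prod_(k < N) Nc k) * Er P zx
           + (\sum_(k < N) (\prod_(k.+1 <= j < N) Nc j) * Mc k
                           * (\prod_(j < k) f j)
              - \prod_(k < N) f k) * Er P zy)%:E].
Proof.
move=> EB W1 W2 H1 H2 H3 H4 b1 b2 SxN TxN SxyN TxyN SyN TyN.
move=> Sx_rec Tx_rec Sxy_rec Txy_rec Sy_rec Ty_rec zx zy hzx hzy mean_noise cov_noise.
pose uo := optimal_control P a f B zx zy Rw Sx Tx Sxy Txy.
exists uo; split.
- by move=> k _ t; exact: optimal_controlE.
- exact: (optimal_minimizer hB2 hzx hzy mean_noise cov_noise hRsym hRpos hq hqbar
    SxN TxN SxyN TxyN SyN TyN).
- exact: (minimizer_unique hB2 hzx hzy mean_noise cov_noise hRsym hRpos hq hqbar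
    SxN TxN SxyN TxyN SyN TyN).
- rewrite -(value_at0 a f B hzx hzy Sx Tx Sxy Txy Sy Ty uo).
  exact: (cost_optimal hB2 hzx hzy mean_noise cov_noise hRsym hRpos hq hqbar
    SxN TxN SxyN TxyN SyN TyN).
- exact: (Er_optimal_surplus a f hB2 hzx hzy mean_noise cov_noise Rw Sx Tx Sxy Txy).
Qed.
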